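(* For every MCFTG $G$ with terminal alphabet $\Sigma$ such that $L(G)$ is root consistent, there is an $\mathrm{LDT}^{\mathrm R}$-equivalent MC-TAG $G'$ such that \[\mu(G')\le\begin{cases}\mu(G)&\text{if }\theta(G)=0\\ \mu(G)\cdot|\Sigma|\cdot\mathrm{mr}_\Sigma^2\cdot(2\cdot\theta(G)-1)&\text{if }\theta(G)\ge1.\end{cases}\] Moreover, for $\Delta\subseteq\Sigma$, if $G$ is $\Delta$-lexicalized, then so is $G'$.
   Context: **Sequences and trees.** $\mathbb N_0$ is the set of nonnegative integers, $[n]=\{1,\dots,n\}$. $A^*$ (resp. $A^+$) is the set of finite (resp. nonempty finite) sequences over $A$; a sequence of length 1 is identified with its element; juxtaposition is concatenation; $\mathrm{occ}(w)$ is the set of elements occurring in the sequence $w$; $w$ is repetition-free if no element occurs twice in it. A ranked alphabet is a set $\Sigma$ with a rank map $\mathrm{rk}\colon\Sigma\to\mathbb N_0$ (applied elementwise to sequences); $\Sigma^{(k)}$ is the set of symbols of rank $k$; for finite $\Sigma$, $\mathrm{mr}_\Sigma$ is the maximal rank of its symbols. $T_\Sigma$ is the set of trees over $\Sigma$: the smallest set of strings over $\Sigma$ containing $\sigma t_1\cdots t_k$ (also written $\sigma(t_1,\dots,t_k)$) for all $\sigma\in\Sigma^{(k)}$ and $t_i\in T_\Sigma$. A forest is a finite sequence of trees. $X=\{x_1,x_2,\dots\}$ is a set of variables (of rank 0, disjoint from other alphabets), $X_k=\{x_1,\dots,x_k\}$. A pattern of rank $k$ over $\Sigma$ is a tree over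 $\Sigma\cup X_k$ in which each of $x_1,\dots,x_k$ occurs exactly once; $P_\Sigma(X_k)$ is the set of these and $P_\Sigma(X)=\bigcup_k P_\Sigma(X_k)$. For a forest $t$, $\mathrm{occ}_\Omega(t)$ is the set of symbols of $\Omega$ occurring in $t$; $t$ is uniquely $\Omega$-labeled if each symbol of $\Omega$ occurs at most once in $t$. **Substitution.** For a repetition-free sequence of symbols $\sigma=(\sigma_1,\dots,\sigma_n)$ and patterns $u=(u_1,\dots,u_n)$ with $\mathrm{rk}(u)=\mathrm{rk}(\sigma)$, $t[\sigma\gets u]$ is obtained from $t$ by replacing, recursively, each subtree $\sigma_i(s_1,\dots,s_k)$ by $u_i$ in which $x_j$ is replaced by the transformed $s_j$ (componentwise on forests). For $\mathcal L=\{B_1,\dots,B_k\}$ with $B_1\cdots B_k$ repetition-free and forests $f(B_i)$ with $\mathrm{rk}(f(B_i))=\mathrm{rk}(B_i)$, $t[B\gets f(B)\mid B\in\mathcal L]$ means $t[B_1\cdots B_k\gets f(B_1)\cdots f(B_k)]$. **MCFTG.** A multiple context-free tree grammar (MCFTG) is $G=(N,\mathcal N,\Sigma,S,R)$ where $N$ is a finite ranked alphabet of nonterminals; $\mathcal N\subseteq N^+$ is a finite set of repetition-free sequences (big nonterminals) with $\mathrm{occ}(A)\ne\mathrm{occ}(A')$ for distinct $A,A'\in\mathcal N$; $\Sigma$ is a finite ranked alphabet of terminals, disjoint from $N$, with $\mathrm{mr}_\Sigma\ge1$; $S\in\mathcal N\cap N^{(0)}$ is the initial nonterminal; $R$ is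 a finite set of rules $A\to(u,\mathcal L)$ with $A\in\mathcal N$, $u\in P_{N\cup\Sigma}(X)^+$ a uniquely $N$-labeled forest with $\mathrm{rk}(u)=\mathrm{rk}(A)$, and $\mathcal L\subseteq\mathcal N$ (the links) such that the sets $\mathrm{occ}(B)$, $B\in\mathcal L$, are pairwise disjoint with union $\mathrm{occ}_N(u)$. The sets $L(G,A)$, $A\in\mathcal N$, are simultaneously the smallest sets of forests such that for every rule $A\to(u,\mathcal L)$ and all $f(B)\in L(G,B)$ ($B\in\mathcal L$), $u[B\gets f(B)\mid B\in\mathcal L]\in L(G,A)$. $L(G)=L(G,S)\subseteq T_\Sigma$. The multiplicity is $\mu(G)=\max\{|A|: A\in\mathcal N\}$; the width is $\theta(G)=\max\{\mathrm{rk}(C): C\in N\}$. Convention: every MCFTG is start-separated, i.e. $S$ does not occur in right-hand sides of rules. **Derivation trees.** For every rule fix a linear order on its links; a rule with $k$ links has rank $k$, so $R$ is a ranked alphabet. The sets $L(G_{\mathrm{der}},A)\subseteq T_R$ are the smallest sets such that $\rho(d_1,\dots,d_k)\in L(G_{\mathrm{der}},A)$ whenever $\rho=A\to(u,\{B_1,\dots,B_k\})\in R$ (links in their order) and $d_i\in L(G_{\mathrm{der}},B_i)$; and $\mathrm{val}(\rho(d_1,\dots,d_k))=u[B_i\gets\mathrm{val}(d_i)\mid 1\le i\le k]$. $L(G_{\mathrm{der}})=L(G_{\mathrm{der}},S)$. **$\mathrm{LDT}^{\mathrm R}$-equivalence.** A linear deterministic top-down tree transducer with regular look-ahead ($\mathrm{LDT}^{\mathrm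 R}$-transducer) from $\Omega$ to $\Sigma$ has a finite state set $Q$, an initial state $q_0$, and finitely many rules $\langle q,\omega(y_1{:}L_1,\dots,y_k{:}L_k){:}L_0\rangle\to\zeta$ with $q\in Q$, $\omega\in\Omega^{(k)}$, $L_0,\dots,L_k$ regular tree languages over $\Omega$, and $\zeta$ a tree over $\Sigma$ and rank-0 symbols $\langle q',y_i\rangle$ ($q'\in Q$, $i\in[k]$) in which each $y_i$ occurs at most once; for two distinct rules with the same $q,\omega$ and look-ahead languages $L_i$, $L_i'$ there is $0\le i\le k$ with $L_i\cap L_i'=\emptyset$. For $s=\omega(s_1,\dots,s_k)$, $M_q(s)=\zeta[\langle q',y_i\rangle\gets M_{q'}(s_i)]$ if there is a rule $\langle q,\omega(y_1{:}L_1,\dots,y_k{:}L_k){:}L_0\rangle\to\zeta$ with $s\in L_0$, $s_i\in L_i$ for all $i\in[k]$ (undefined if there is no such rule or some needed $M_{q'}(s_i)$ is undefined); it realizes the partial function $M=M_{q_0}\colon T_\Omega\to T_\Sigma$. MCFTGs $G,G'$ with the same terminal alphabet and rule sets $R,R'$ are $\mathrm{LDT}^{\mathrm R}$-equivalent if there are such transductions $M\colon T_R\to T_{R'}$, $M'\colon T_{R'}\to T_R$ with $M(d)\in L(G'_{\mathrm{der}})$ and $\mathrm{val}(M(d))=\mathrm{val}(d)$ for all $d\in L(G_{\mathrm{der}})$, and $M'(d')\in L(G_{\mathrm{der}})$ and $\mathrm{val}(M'(d'))=\mathrm{val}(d')$ for all $d'\in L(G'_{\mathrm{der}})$ (so $L(G)=L(G')$).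 **Lexicalization.** A rule $A\to(u,\mathcal L)$ is initial if $A=S$, terminal if $\mathcal L=\emptyset$, proper if it is not both initial and terminal, and $\Delta$-lexicalized if some symbol of $\Delta$ occurs in $u$. $G$ is $\Delta$-lexicalized if all its proper rules are. **MC-TAG.** A pattern $t\in P_{N\cup\Sigma}(X_k)$ is footed if either $k=0$, or $k\ge1$ and $t$ has a node (the foot node) labeled by a symbol of $N\cup\Sigma$ of rank $k$ whose $i$-th child is labeled $x_i$ for every $i\in[k]$. An MCFTG is footed if for each rule $A\to((u_1,\dots,u_n),\mathcal L)$ all $u_j$ are footed. An MC-TAG (strict set-local multi-component tree adjoining grammar) is a footed MCFTG for which there is an equivalence relation $\equiv$ on $N\cup\Sigma$ such that (1) for all $\sigma,\tau\in\Sigma$, if $\sigma\ne\tau$ and $\sigma\equiv\tau$ then $\mathrm{rk}(\sigma)\ne\mathrm{rk}(\tau)$; (2) for every $C\in N$ there is $\sigma\in\Sigma$ with $C\equiv\sigma$; (3) for every rule $(A_1,\dots,A_n)\to((u_1,\dots,u_n),\mathcal L)$ and $j\in[n]$, the root label of $u_j$ is $\equiv A_j$, and if $\mathrm{rk}(A_j)\ge1$ then the label of the foot node of $u_j$ is $\equiv A_j$. A tree language $L$ is root consistent if any two trees in $L$ with different root labels have root labels of different ranks. *)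

(* Defs.v *)
From HB Require Import structures.
From mathcomp Require Import all_boot.

Set Implicit Arguments.
Unset Strict Implicit.
Unset Printing Implicit Defensive.

Record ralphabet := RAlphabet { rsort :> finType; rk : rsort -> nat }.

Definition mr (Omega : ralphabet) : nat := \max_(a : Omega) rk a.

(* The disjoint union of N and Sigma: disjointness of the nonterminal and
   terminal alphabets is built into the type. *)
Definition sumA (N Sigma : ralphabet) : ralphabet :=
  @RAlphabet (N + Sigma)%type
    (fun x => match x with inl C => rk C | inr a => rk a end).

(* [tree A V]: trees with inner symbols in A and additional symbols of rank 0
   (variables, state calls) in V. The well-rankedness is the predicate
   [ranked] below, so T_Omega is the set of ranked trees in
   [tree Omega void].
   The variable x_(i+1) is [Leaf i]: variables are numbered from 0. *)
Inductive tree (A V : Type) : Type :=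
| Leaf of V
| Node of A & seq (tree A V).

Arguments Leaf {A V} _.
Arguments Node {A V} _ _.

Section TreeCountable.

Variables A V : Type.

Lemma tree_ind_all (P : tree A V -> Prop) :
  (forall v, P (Leaf v)) ->
  (forall a ts, foldr (fun t p => P t /\ p) True ts -> P (Node a ts)) ->
  forall t, P t.
Proof.
move=> PL PN; fix IH 1; case=> [v|a ts]; first exact: PL.
by apply: PN; elim: ts => [|t ts IHts] //; split.
Qed.

Fixpoint tree_encode (t : tree A V) : GenTree.tree (A + V) :=
  match t with
  | Leaf v => GenTree.Leaf (inr v)
  | Node a ts => GenTree.Node 0 (GenTree.Leaf (inl a) :: map tree_encode ts)
  end.

Fixpoint tree_decode (e : GenTree.tree (A + V)) : option (tree A V) :=
  match e with
  | GenTree.Leaf (inr v) => Some (Leaf v)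
  | GenTree.Node _ (GenTree.Leaf (inl a) :: es) =>
      Some (Node a (pmap tree_decode es))
  | _ => None
  end.

Lemma tree_encodeK : pcancel tree_encode tree_decode.
Proof.
elim/tree_ind_all => [v|a ts IH] //=; congr (Some (Node a _)).
by elim: ts IH => //= t ts IHts [-> /IHts ->].
Qed.

End TreeCountable.

HB.instance Definition _ (A V : eqType) :=
  Equality.copy (tree A V) (pcan_type (@tree_encodeK A V)).
HB.instance Definition _ (A V : choiceType) :=
  Choice.copy (tree A V) (pcan_type (@tree_encodeK A V)).

Section Trees.

Variables A V : Type.

Fixpoint syms (t : tree A V) : seq A :=
  match t with
  | Leaf _ => [::]
  | Node a ts => a :: flatten (map syms ts)
  end.

Fixpoint leaves (t : tree A V) : seq V :=
  match t with
  | Leaf v => [:: v]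
  | Node _ ts => flatten (map leaves ts)
  end.

Fixpoint subtrees (t : tree A V) : seq (tree A V) :=
  t :: match t with
       | Leaf _ => [::]
       | Node _ ts => flatten (map subtrees ts)
       end.

Definition troot (t : tree A V) : option A :=
  match t with Leaf _ => None | Node a _ => Some a end.

Fixpoint lsubst (W : Type) (g : V -> tree A W) (t : tree A V) : tree A W :=
  match t with
  | Leaf v => g v
  | Node a ts => Node a (map (lsubst g) ts)
  end.

End Trees.

Fixpoint ranked (Omega : ralphabet) (V : Type) (t : tree Omega V) : bool :=
  match t with
  | Leaf _ => true
  | Node a ts => (size ts == rk a) && all (@ranked Omega V) ts
  end.

Definition pattern (Omega : ralphabet) (k : nat) (t : tree Omega nat) : bool :=
  ranked t && perm_eq (leaves t) (iota 0 k).

(* [tsubst s u t] is t[s <- u]. It is only used when s contains every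
   nonterminal of t and u consists of patterns over Sigma, so that the result
   is a tree over Sigma; the default value of [nth] is then irrelevant. *)
Fixpoint tsubst (N : eqType) (Sigma : Type) (s : seq N)
    (u : seq (tree Sigma nat)) (t : tree (N + Sigma) nat) : tree Sigma nat :=
  match t with
  | Leaf i => Leaf i
  | Node (inl C) ts =>
      lsubst (nth (Leaf 0) (map (tsubst s u) ts)) (nth (Leaf 0) u (index C s))
  | Node (inr a) ts => Node a (map (tsubst s u) ts)
  end.

Section Rules.

Variables N Sigma : Type.

(* The rule lhs -> (rhs, links). The set of links is given together with its
   fixed linear order, as a sequence. *)
Record rule := Rule {
  lhs : seq N;
  rhs : seq (tree (N + Sigma) nat);
  links : seq (seq N)
}.

Definition rule_encode (r : rule) := (lhs r, rhs r, links r).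
Definition rule_decode (p : seq N * seq (tree (N + Sigma) nat) * seq (seq N)) :=
  Rule p.1.1 p.1.2 p.2.

Lemma rule_encodeK : cancel rule_encode rule_decode.
Proof. by case. Qed.

Definition occN (u : seq (tree (N + Sigma) nat)) : seq N :=
  pmap (fun x => if x is inl C then Some C else None) (flatten (map (@syms _ _) u)).

Definition occT (u : seq (tree (N + Sigma) nat)) : seq Sigma :=
  pmap (fun x => if x is inr a then Some a else None) (flatten (map (@syms _ _) u)).

End Rules.

HB.instance Definition _ (N Sigma : eqType) :=
  Equality.copy (rule N Sigma) (can_type (@rule_encodeK N Sigma)).
HB.instance Definition _ (N Sigma : choiceType) :=
  Choice.copy (rule N Sigma) (can_type (@rule_encodeK N Sigma)).

Definition valid_rule (N Sigma : ralphabet) (bigN : seq (seq N))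
    (r : rule N Sigma) : Prop :=
  [/\ lhs r \in bigN,
      all2 (fun (C : N) t => @pattern (sumA N Sigma) (rk C) t) (lhs r) (rhs r)
    & uniq (occN (rhs r))] /\
  [/\ uniq (links r),
      {subset links r <= bigN},
      {in links r &, forall B B' : seq N, B != B' -> [disjoint B & B']}
    & flatten (links r) =i occN (rhs r)].

(* The finite sets of big nonterminals and of rules are given by enumerations,
   of which only the membership matters. A rule carries an order on its links,
   so [mc_link_order] says that each rule comes with a single such order. *)
Record mcftg (Sigma : ralphabet) := Mcftg {
  nt : ralphabet;
  bign : seq (seq nt);
  init : nt;
  rules : seq (rule nt Sigma);
  mc_mr : 0 < mr Sigma;
  mc_bign : {in bign, forall B, B != [::] /\ uniq B};
  mc_bign_occ : {in bign &, forall B B' : seq nt, B =i B' -> B = B'};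
  mc_init : [:: init] \in bign;
  mc_init_rk : rk init = 0;
  mc_rules : {in rules, forall r, valid_rule bign r};
  mc_link_order : {in rules &, forall r r' : rule nt Sigma,
    lhs r = lhs r' -> rhs r = rhs r' -> links r =i links r' -> r = r'};
  mc_start_separated : {in rules, forall r, init \notin occN (rhs r)}
}.

Section Grammar.

Variables (Sigma : ralphabet) (G : mcftg Sigma).

(* [lang A] is L(G, A). *)
Inductive lang : seq (nt G) -> seq (tree Sigma nat) -> Prop :=
| Lang (r : rule (nt G) Sigma) (f : seq (nt G) -> seq (tree Sigma nat)) :
    r \in rules G ->
    (forall B, B \in links r -> lang B (f B)) ->
    lang (lhs r)
      (map (tsubst (flatten (links r)) (flatten (map f (links r)))) (rhs r)).

Definition tree_lang (t : tree Sigma nat) : Prop := lang [:: init G] [:: t].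

Definition multiplicity : nat := \max_(A <- bign G) size A.

Definition width : nat := mr (nt G).

Definition ruleA : ralphabet :=
  @RAlphabet (seq_sub (rules G)) (fun r => size (links (ssval r))).

(* [der A] is L(G_der, A). *)
Inductive der : seq (nt G) -> tree ruleA void -> Prop :=
| Der (r : ruleA) (ds : seq (tree ruleA void)) :
    size ds = rk r ->
    (forall B d, (B, d) \in zip (links (ssval r)) ds -> der B d) ->
    der (lhs (ssval r)) (Node r ds).

Definition der_lang : tree ruleA void -> Prop := der [:: init G].

Fixpoint tval (d : tree ruleA void) : seq (tree Sigma nat) :=
  match d with
  | Leaf v => match v with end
  | Node r ds =>
      map (tsubst (flatten (links (ssval r))) (flatten (map tval ds)))
          (rhs (ssval r))
  end.

Definition initial_rule (r : rule (nt G) Sigma) : bool := lhs r == [:: init G].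
Definition terminal_rule (r : rule (nt G) Sigma) : bool := links r == [::].
Definition proper_rule (r : rule (nt G) Sigma) : bool :=
  ~~ (initial_rule r && terminal_rule r).

Definition lexicalized_rule (Delta : {set Sigma}) (r : rule (nt G) Sigma) : bool :=
  has (fun a => a \in Delta) (occT (rhs r)).

Definition lexicalized (Delta : {set Sigma}) : Prop :=
  {in rules G, forall r, proper_rule r -> lexicalized_rule Delta r}.

End Grammar.

(* Regular = recognized by a finite total deterministic bottom-up automaton
   with transition function [delta] and set of final states [F]. *)
Fixpoint run (Omega Q : Type) (delta : Omega -> seq Q -> Q)
    (t : tree Omega void) : Q :=
  match t with
  | Leaf v => match v with end
  | Node a ts => delta a (map (run delta) ts)
  end.

Definition regular (Omega : ralphabet) (L : tree Omega void -> Prop) : Prop :=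
  exists (Q : finType) (delta : Omega -> seq Q -> Q) (F : {set Q}),
    forall t, L t <-> ranked t /\ run delta t \in F.

Definition disjoint_lang (T : Type) (L L' : T -> Prop) : Prop :=
  forall t, ~ (L t /\ L' t).

(* The rules are indexed by [trule]. Rule r is
     < tstate r, (tsym r)(y_1 : L_1, ..., y_k : L_k) : L_0 > -> trhs r
   with k = rk (tsym r), L_0 = tla0 r and L_(i+1) = tla r i for i < k; the
   languages [tla r i] with k <= i play no role. The leaf (q, i) of [trhs r]
   is the symbol < q, y_(i+1) >. *)
Record ldtr (Omega Sigma : ralphabet) := Ldtr {
  state : finType;
  tinit : state;
  trule : finType;
  tstate : trule -> state;
  tsym : trule -> Omega;
  tla0 : trule -> tree Omega void -> Prop;
  tla : trule -> nat -> tree Omega void -> Prop;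
  trhs : trule -> tree Sigma (state * nat);
  tla0_regular : forall r, regular (tla0 r);
  tla_regular : forall r i, i < rk (tsym r) -> regular (tla r i);
  trhs_ranked : forall r, ranked (trhs r);
  trhs_bound : forall r, all (fun p => p.2 < rk (tsym r)) (leaves (trhs r));
  trhs_linear : forall r, uniq (map snd (leaves (trhs r)));
  tdeterministic : forall r r', r != r' ->
    tstate r = tstate r' -> tsym r = tsym r' ->
    disjoint_lang (tla0 r) (tla0 r') \/
    exists2 i, i < rk (tsym r) & disjoint_lang (tla r i) (tla r' i)
}.

(* [trans M q s t] is M_q(s) = t: the graph of the partial function M_q. *)
Inductive trans (Omega Sigma : ralphabet) (M : ldtr Omega Sigma) :
    state M -> tree Omega void -> tree Sigma void -> Prop :=
| Trans (r : trule M) (ss : seq (tree Omega void))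
    (g : state M * nat -> tree Sigma void) :
    size ss = rk (tsym r) ->
    tla0 r (Node (tsym r) ss) ->
    (forall i s, onth ss i = Some s -> tla r i s) ->
    (forall q i s, (q, i) \in leaves (trhs r) -> onth ss i = Some s ->
       trans q s (g (q, i))) ->
    trans (tstate r) (Node (tsym r) ss) (lsubst g (trhs r)).

Definition ldtr_simulates (Sigma : ralphabet) (G G' : mcftg Sigma) : Prop :=
  exists M : ldtr (ruleA G) (ruleA G'),
    forall d, der_lang d ->
      exists d', [/\ trans (tinit M) d d', der_lang d' & tval d' = tval d].

Definition ldtr_equivalent (Sigma : ralphabet) (G G' : mcftg Sigma) : Prop :=
  ldtr_simulates G G' /\ ldtr_simulates G' G.

Definition is_foot (Omega : ralphabet) (k : nat) (t : tree Omega nat)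
    (a : Omega) : bool :=
  (rk a == k) && (Node a (map Leaf (iota 0 k)) \in subtrees t).

Definition footed_pattern (Omega : ralphabet) (k : nat) (t : tree Omega nat) :
    Prop :=
  k = 0 \/ 0 < k /\ exists a, is_foot k t a.

Definition footed (Sigma : ralphabet) (G : mcftg Sigma) : Prop :=
  {in rules G, forall r, forall C t, (C, t) \in zip (lhs r) (rhs r) ->
    @footed_pattern (sumA (nt G) Sigma) (rk C) t}.

Definition mc_tag (Sigma : ralphabet) (G : mcftg Sigma) : Prop :=
  footed G /\
  exists2 e : rel (sumA (nt G) Sigma),
    [/\ reflexive e, symmetric e & transitive e] &
    [/\ (forall a b : Sigma, a != b -> e (inr a) (inr b) -> rk a != rk b),
        (forall C : nt G, exists a : Sigma, e (inl C) (inr a))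
      & {in rules G, forall r, forall C t, (C, t) \in zip (lhs r) (rhs r) ->
           (exists2 a, troot t = Some a & e a (inl C)) /\
           (0 < rk C ->
              exists2 a, @is_foot (sumA (nt G) Sigma) (rk C) t a & e a (inl C))}].

Definition root_consistent (Sigma : ralphabet) (L : tree Sigma nat -> Prop) : Prop :=
  forall t t' a a', L t -> L t' -> troot t = Some a -> troot t' = Some a' ->
    a != a' -> rk a != rk a'.

(* Main.v *)
Require Import Defs.
From mathcomp Require Import all_boot zify boolp.

Set Implicit Arguments.
Unset Strict Implicit.
Unset Printing Implicit Defensive.

(* Every tree that occurs in a right-hand side is cut into footed pieces whose
   root and foot carry the same class in Sigma, where a nonterminal of the new
   grammar has a terminal symbol as its class. What remains is a skeleton, a
   tree over Sigma whose nodes stand for the pieces. Along every branch no two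
   nodes of the skeleton have the same class and the same nonzero number of
   variables below them, since otherwise the segment between them can be merged
   into one piece. Hence a skeleton with k > 0 variables has at most
   |Sigma| * mr Sigma * (2k-1) nodes, and there are finitely many skeletons.
   The big nonterminals of the new grammar are the pairs of a big nonterminal A
   and a forest of skeletons for A; a rule is obtained by substituting labelled
   skeletons for the links of a rule of G and cutting the result into pieces.
   The forest of skeletons of a derivation is computed by a bottom-up automaton,
   which is the look-ahead of the transducer from G to the new grammar. Links
   whose skeletons have no node (all their trees are variables) disappear, and
   the transducer back to G replaces them by constant derivations. *)

(** * Trees and second-order substitution *)

(** The difficulty is that a rule of [G] must be cut before the values of its links are known. A
    label stands for such an unknown value, but its class and rank are fixed in advance: the value
    has exactly that rank, and its root symbol is the class of the label. Hence a cut made on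
    symbols and labels stays correct for all values. Since second-order substitution is associative,
    evaluating the pieces and plugging them into the skeleton gives the same tree as evaluating
    without cutting. Plugging skeletons into one another would let them grow along a derivation; the
    expanded right-hand side is therefore cut afresh, which restores the size bound and keeps the
    set of states finite. The decomposition of a tree is not unique. One is chosen once and for all,
    so that the skeleton of a left-hand side is a function of the rule and of the skeletons of its
    links, as a deterministic look-ahead automaton requires. *)

Lemma perm_flatten_map (T U : eqType) (f g : T -> seq U) (s : seq T) :
  {in s, forall x, perm_eq (f x) (g x)} ->
  perm_eq (flatten (map f s)) (flatten (map g s)).
Proof.
elim: s => //= x s IH fg; apply: perm_cat; first by apply: fg; rewrite mem_head.
by apply: IH => y ys; apply: fg; rewrite inE ys orbT.
Qed.

Lemma flatten_flatten (T : Type) (sss : seq (seq (seq T))) :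
  flatten (flatten sss) = flatten (map flatten sss).
Proof. by elim: sss => //= ss sss <-; rewrite flatten_cat. Qed.

Lemma all_map_flatten (T U : eqType) (p : pred U) (f : T -> seq U) (s : seq T) :
  all (fun x => all p (f x)) s = all p (flatten (map f s)).
Proof. by elim: s => //= x s ->; rewrite all_cat. Qed.

Lemma tree_ind_in (A V : eqType) (P : tree A V -> Prop) :
  (forall v, P (Leaf v)) ->
  (forall a ts, {in ts, forall t, P t} -> P (Node a ts)) ->
  forall t, P t.
Proof.
move=> PL PN; elim/tree_ind_all => // a ts IH; apply: PN.
elim: ts IH => //= t ts IHts [Pt /IHts Pts] t'.
by rewrite inE => /predU1P[->|/Pts].
Qed.

(** The number of children is recorded with each symbol, so that rankedness and linearity become
    conditions on the members of a list, which permutations preserve. *)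
Fixpoint nodes (A V : Type) (t : tree A V) : seq (A * nat) :=
  match t with
  | Leaf _ => [::]
  | Node a ts => (a, size ts) :: flatten (map (@nodes A V) ts)
  end.

Fixpoint tmap (A B V : Type) (f : A -> B) (t : tree A V) : tree B V :=
  match t with
  | Leaf v => Leaf v
  | Node a ts => Node (f a) (map (tmap f) ts)
  end.

(* [gsub h t] replaces every node labelled a by the pattern [h a]. It respects
   composition and the symbols and leaves of t only if [h a] is linear in exactly
   as many variables as the node has children, which is [hlinear]. *)
Fixpoint gsub (A B : Type) (h : A -> tree B nat) (t : tree A nat) : tree B nat :=
  match t with
  | Leaf i => Leaf i
  | Node a ts => lsubst (nth (Leaf 0) (map (gsub h) ts)) (h a)
  end.

Section Generic.
Variables (A V : eqType).
Implicit Type t : tree A V.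

Lemma map_nth_iota_size (T : Type) (x0 : T) (s : seq T) :
  map (nth x0 s) (iota 0 (size s)) = s.
Proof. exact: mkseq_nth. Qed.

Lemma symsE t : syms t = map fst (nodes t).
Proof.
elim/tree_ind_in: t => //= a ts IH; congr cons.
by rewrite map_flatten -map_comp; congr flatten; apply/eq_in_map => t /IH.
Qed.

Lemma size_nodes t : size (nodes t) = size (syms t).
Proof. by rewrite symsE size_map. Qed.

Lemma lsubst_comp (W X : eqType) (f : V -> tree A W) (g : W -> tree A X) t :
  lsubst g (lsubst f t) = lsubst (fun v => lsubst g (f v)) t.
Proof.
elim/tree_ind_in: t => //= a ts IH; congr Node.
by rewrite -map_comp; apply/eq_in_map => t /IH.
Qed.

Lemma eq_in_lsubst (W : eqType) (f g : V -> tree A W) t :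
  {in leaves t, f =1 g} -> lsubst f t = lsubst g t.
Proof.
elim/tree_ind_in: t => [v|a ts IH] /= fg; first by apply: fg; rewrite mem_head.
congr Node; apply/eq_in_map => t tts; apply: IH => // v vt.
by apply: fg; apply/flatten_mapP; exists t.
Qed.

Lemma lsubst_Leaf t : lsubst Leaf t = t.
Proof.
by elim/tree_ind_in: t => //= a ts IH; congr Node; apply: map_id_in => t /IH.
Qed.

Lemma lsubst_closed (f : V -> tree A V) t : leaves t = [::] -> lsubst f t = t.
Proof. by move=> t0; rewrite -[RHS]lsubst_Leaf; apply: eq_in_lsubst; rewrite t0. Qed.

Lemma leaves_lsubst (W : eqType) (g : V -> tree A W) t :
  leaves (lsubst g t) = flatten (map (fun v => leaves (g v)) (leaves t)).
Proof.
elim/tree_ind_in: t => [v|a ts IH] /=; first by rewrite cats0.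
rewrite map_flatten flatten_flatten -!map_comp; congr flatten.
by apply/eq_in_map => t /IH.
Qed.

Lemma nodes_lsubst (W : eqType) (g : V -> tree A W) t :
  perm_eq (nodes (lsubst g t))
          (nodes t ++ flatten (map (fun v => nodes (g v)) (leaves t))).
Proof.
elim/tree_ind_in: t => [v|a ts IH] /=; first by rewrite cats0.
rewrite size_map perm_cons -map_comp map_flatten flatten_flatten -map_comp.
elim: ts IH => //= t ts IHts IH.
rewrite perm_sym; apply: perm_trans (_ : perm_eq _
  ((nodes t ++ flatten [seq nodes (g v) | v <- leaves t]) ++
   flatten (map (@nodes A V) ts) ++
   flatten [seq flatten [seq nodes (g v) | v <- leaves t'] | t' <- ts])) _.
  by rewrite -!catA perm_cat2l -map_comp perm_catCA.
rewrite perm_sym; apply: perm_cat; first by apply: IH; rewrite mem_head.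
rewrite -map_comp in IHts; apply: IHts => t' t'ts.
by apply: IH; rewrite inE t'ts orbT.
Qed.

Lemma leaves_tmap (B : Type) (f : A -> B) t : leaves (tmap f t) = leaves t.
Proof.
elim/tree_ind_in: t => //= a ts IH; congr flatten.
by rewrite -map_comp; apply/eq_in_map => t /IH.
Qed.

Lemma nodes_tmap (B : Type) (f : A -> B) t :
  nodes (tmap f t) = [seq (f x.1, x.2) | x <- nodes t].
Proof.
elim/tree_ind_in: t => //= a ts IH; congr cons; first by rewrite size_map.
by rewrite map_flatten -!map_comp; congr flatten; apply/eq_in_map => t /IH.
Qed.

Lemma subtrees_refl t : t \in subtrees t.
Proof. by case: t => *; rewrite mem_head. Qed.

Lemma subtrees_child a ts t t' : t \in ts -> t' \in subtrees t ->
  t' \in subtrees (Node a ts).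
Proof. by move=> tts t't; rewrite inE; apply/orP; right; apply/flatten_mapP;
  exists t. Qed.

Lemma nodes_child a ts t x : t \in ts -> x \in nodes t -> x \in nodes (Node a ts).
Proof. by move=> tts xt; rewrite inE; apply/orP; right; apply/flatten_mapP;
  exists t. Qed.

Lemma subtrees_trans t1 t2 t3 :
  t1 \in subtrees t2 -> t2 \in subtrees t3 -> t1 \in subtrees t3.
Proof.
move=> t12; elim/tree_ind_in: t3 => [v|a ts IH]; first by rewrite inE => /eqP <-.
rewrite inE => /predU1P[<-//|/flatten_mapP[t tts /IH]].
by move=> /(_ tts); apply: subtrees_child.
Qed.

Lemma nodesP t a n :
  reflect (exists2 ts, size ts = n & Node a ts \in subtrees t) ((a, n) \in nodes t).
Proof.
apply: (iffP idP).
  elim/tree_ind_in: t => //= b ts IH; rewrite inE => /predU1P[[-> ->]|].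
    by exists ts => //; rewrite mem_head.
  case/flatten_mapP => t tts /(IH _ tts)[ts' ? sub]; exists ts' => //.
  exact: subtrees_child sub.
case=> ts <-; elim/tree_ind_in: t => [v|b ts' IH]; first by rewrite inE.
rewrite inE => /predU1P[[-> ->]|]; first by rewrite mem_head.
by case/flatten_mapP => t tts /(IH _ tts); apply: nodes_child.
Qed.

Lemma subtrees_lsubst (W : eqType) (g : V -> tree A W) t v (t' : tree A W) :
  v \in leaves t -> t' \in subtrees (g v) -> t' \in subtrees (lsubst g t).
Proof.
elim/tree_ind_in: t => [w|a ts IH] /=; first by rewrite inE => /eqP ->.
case/flatten_mapP => t tts vt t'v; rewrite inE; apply/orP; right.
apply/flatten_mapP; exists (lsubst g t); first exact: map_f.
exact: IH.
Qed.

End Generic.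

Section Gsub.
Variables (A B : eqType).

Definition hlinear (h : A -> tree B nat) (t : tree A nat) :=
  {in nodes t, forall x, perm_eq (leaves (h x.1)) (iota 0 x.2)}.

Lemma hlinear_child h a ts t : hlinear h (Node a ts) -> t \in ts -> hlinear h t.
Proof. by move=> ht tts x xt; apply: ht; apply: nodes_child xt. Qed.

Lemma hlinear_root h a ts : hlinear h (Node a ts) ->
  perm_eq (leaves (h a)) (iota 0 (size ts)).
Proof. by move/(_ (a, size ts)); apply; rewrite mem_head. Qed.

Lemma eq_in_gsub (h h' : A -> tree B nat) t :
  {in nodes t, forall x, h x.1 = h' x.1} -> gsub h t = gsub h' t.
Proof.
elim/tree_ind_in: t => //= a ts IH hh.
rewrite (hh (a, size ts)) ?mem_head //; congr lsubst; congr nth.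
apply/eq_in_map => t tts; apply: IH => // x xt; apply: hh; exact: nodes_child xt.
Qed.

Lemma leaves_gsub (h : A -> tree B nat) t : hlinear h t ->
  perm_eq (leaves (gsub h t)) (leaves t).
Proof.
elim/tree_ind_in: t => //= a ts IH ht; rewrite leaves_lsubst.
have ha := hlinear_root ht.
apply: perm_trans (perm_flatten (perm_map _ ha)) _.
rewrite (map_comp (@leaves _ _)) -[size ts](size_map (gsub h)) map_nth_iota_size
  -map_comp.
by apply: perm_flatten_map => t tts /=; exact/IH/(hlinear_child ht tts).
Qed.

Lemma nodes_gsub (h : A -> tree B nat) t : hlinear h t ->
  perm_eq (nodes (gsub h t)) (flatten [seq nodes (h x.1) | x <- nodes t]).
Proof.
elim/tree_ind_in: t => //= a ts IH ht.
apply: perm_trans (nodes_lsubst _ _) _; rewrite perm_cat2l.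
have ha := hlinear_root ht.
apply: perm_trans (perm_flatten (perm_map _ ha)) _.
rewrite (map_comp (@nodes _ _)) -[size ts](size_map (gsub h)) map_nth_iota_size
  -map_comp.
rewrite map_flatten flatten_flatten -!map_comp.
by apply: perm_flatten_map => t tts /=; exact/IH/(hlinear_child ht tts).
Qed.

Lemma gsub_lsubst (h : A -> tree B nat) g t : hlinear h t ->
  gsub h (lsubst g t) = lsubst (fun v => gsub h (g v)) (gsub h t).
Proof.
elim/tree_ind_in: t => //= a ts IH ht.
rewrite lsubst_comp; apply: eq_in_lsubst => i.
rewrite (perm_mem (hlinear_root ht)) mem_iota add0n /= => ilt.
rewrite !(nth_map (Leaf 0)) ?size_map //; apply: IH; first exact: mem_nth.
by apply: hlinear_child ht _; apply: mem_nth.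
Qed.


End Gsub.

(** Linearity makes every variable of [h1 a] find a child of the node, so the default of [nth] is
    never reached, neither before nor after applying [h2]. *)
Lemma gsub_gsub (A B C : eqType) (h1 : A -> tree B nat) (h2 : B -> tree C nat) t :
  hlinear h1 t -> {in nodes t, forall x, hlinear h2 (h1 x.1)} ->
  gsub h2 (gsub h1 t) = gsub (fun a => gsub h2 (h1 a)) t.
Proof.
elim/tree_ind_in: t => //= a ts IH h1t h2t.
rewrite gsub_lsubst; last by apply: (h2t (a, size ts)); rewrite mem_head.
apply: eq_in_lsubst => i.
have ha := h2t (a, size ts) (mem_head _ _).
rewrite (perm_mem (leaves_gsub ha)) (perm_mem (hlinear_root h1t)) mem_iota add0n /=
  => ilt.
rewrite !(nth_map (Leaf 0)) ?size_map //; apply: IH; first exact: mem_nth.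
  by apply: hlinear_child h1t _; apply: mem_nth.
by move=> x xt; apply: h2t; apply: nodes_child xt; apply: mem_nth.
Qed.

Lemma gsub_tmap (A B C : eqType) (f : A -> B) (h : B -> tree C nat) t :
  gsub h (tmap f t) = gsub (fun a => h (f a)) t.
Proof.
elim/tree_ind_in: t => //= a ts IH; congr lsubst; congr nth.
by rewrite -map_comp; apply/eq_in_map => t /IH.
Qed.

Lemma rankedE (Omega : ralphabet) (V : eqType) (t : tree Omega V) :
  ranked t = all (fun x => x.2 == rk x.1) (nodes t).
Proof.
elim/tree_ind_in: t => //= a ts IH; congr andb.
by rewrite -all_map_flatten; apply: eq_in_all => t /IH.
Qed.

(* [refill b0 l t] relabels the nodes of t in preorder by the list l. *)
Section Refill.
Variables (A B : Type) (V : Type) (b0 : B).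

Fixpoint refill (l : seq B) (t : tree A V) : tree B V :=
  match t with
  | Leaf v => Leaf v
  | Node a ts =>
      Node (head b0 l)
        ((fix refills l ts :=
           match ts with
           | [::] => [::]
           | t :: ts' => refill (take (size (syms t)) l) t ::
                         refills (drop (size (syms t)) l) ts'
           end) (behead l) ts)
  end.

Fixpoint refills (l : seq B) (ts : seq (tree A V)) : seq (tree B V) :=
  match ts with
  | [::] => [::]
  | t :: ts' => refill (take (size (syms t)) l) t ::
                refills (drop (size (syms t)) l) ts'
  end.

(** The guard condition forces a local copy of the list recursion inside [refill]; this trades it
    for [refills]. *)
Lemma refill_Node l a ts :
  refill l (Node a ts) = Node (head b0 l) (refills (behead l) ts).
Proof. by rewrite /=; congr Node; elim: ts (behead l) => //= t ts IH l';
  rewrite IH. Qed.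

Lemma size_refills l ts : size (refills l ts) = size ts.
Proof. by elim: ts l => //= t ts IH l; rewrite IH. Qed.

End Refill.

Section RefillEq.
Variables (A V : eqType).
Implicit Types (t : tree A V) (ts : seq (tree A V)).

Definition fsyms (X W : Type) (ts : seq (tree X W)) := flatten (map (@syms X W) ts).
Definition fnodes (X W : Type) (ts : seq (tree X W)) := flatten (map (@nodes X W) ts).

Lemma fsymsE ts : fsyms ts = unzip1 (fnodes ts).
Proof.
by rewrite /fsyms /fnodes /unzip1 map_flatten -map_comp; congr flatten;
   apply: eq_map => t; rewrite /= symsE.
Qed.

Lemma size_fnodes ts : size (fnodes ts) = size (fsyms ts).
Proof. by rewrite fsymsE size_map. Qed.

Lemma leaves_refill (B : Type) (b0 : B) t l : leaves (refill b0 l t) = leaves t.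
Proof.
elim/tree_ind_in: t l => // a ts IH l; rewrite refill_Node /=.
elim: ts (behead l) IH => //= t ts IHts l' IH.
by rewrite IH ?mem_head // IHts // => t' t'ts; apply: IH; rewrite inE t'ts orbT.
Qed.

(** The claim about trees is a hypothesis, so that the list induction serves inside the tree
    induction and again for forests. *)
Lemma nodes_refill_aux (B : Type) (b0 : B) ts :
  {in ts, forall t l, size l = size (syms t) ->
    nodes (refill b0 l t) = zip l (unzip2 (nodes t))} ->
  forall l, size l = size (fsyms ts) ->
    fnodes (refills b0 l ts) = zip l (unzip2 (fnodes ts)).
Proof.
rewrite /fsyms /fnodes.
elim: ts => [|t ts IHts] IH l /=; first by move/size0nil ->.
rewrite size_cat => sl; rewrite IH ?mem_head ?size_take ?sl //; last first.
  by case: ltnP (leq_addr (size (flatten (map (@syms _ _) ts))) (size (syms t))) =>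
    // h1 h2; apply/eqP; rewrite eqn_leq h1 h2.
rewrite IHts ?size_drop ?sl ?addKn //; last first.
  by move=> t' t'ts; apply: IH; rewrite inE t'ts orbT.
rewrite -[in RHS](cat_take_drop (size (syms t)) l) /unzip2 map_cat zip_cat //.
rewrite size_map size_nodes size_take sl; case: ltnP => // h.
by apply/eqP; rewrite eqn_leq h leq_addr.
Qed.

Lemma nodes_refill (B : Type) (b0 : B) t l : size l = size (syms t) ->
  nodes (refill b0 l t) = zip l (unzip2 (nodes t)).
Proof.
elim/tree_ind_in: t l => [v|a ts IH] l; first by move/size0nil ->.
rewrite refill_Node; case: l => // b l [] sl /=.
by rewrite size_refills; congr cons; apply: nodes_refill_aux.
Qed.

Lemma fnodes_refills (B : Type) (b0 : B) ts l : size l = size (fsyms ts) ->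
  fnodes (refills b0 l ts) = zip l (unzip2 (fnodes ts)).
Proof. by apply: nodes_refill_aux => t _ l'; apply: nodes_refill. Qed.

Lemma tmap_refills_aux (B C : Type) (b0 : B) (c0 : C) (f : B -> C) ts :
  {in ts, forall t l, size l = size (syms t) ->
    tmap f (refill b0 l t) = refill c0 (map f l) t} ->
  forall l, size l = size (fsyms ts) ->
    map (tmap f) (refills b0 l ts) = refills c0 (map f l) ts.
Proof.
rewrite /fsyms.
elim: ts => [|t ts IHts] IH l //=.
rewrite size_cat => sl; rewrite IH ?mem_head ?size_take ?sl //; last first.
  by case: ltnP (leq_addr (size (flatten (map (@syms _ _) ts))) (size (syms t))) =>
    // h1 h2; apply/eqP; rewrite eqn_leq h1 h2.
rewrite IHts ?size_drop ?sl ?addKn ?map_take ?map_drop //.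
by move=> t' t'ts; apply: IH; rewrite inE t'ts orbT.
Qed.

Lemma tmap_refill (B C : Type) (b0 : B) (c0 : C) (f : B -> C) t l :
  size l = size (syms t) -> tmap f (refill b0 l t) = refill c0 (map f l) t.
Proof.
elim/tree_ind_in: t l => [v|a ts IH] l //.
rewrite !refill_Node; case: l => // b l [] sl /=.
by congr Node; apply: tmap_refills_aux.
Qed.

Lemma tmap_refills (B C : Type) (b0 : B) (c0 : C) (f : B -> C) ts l :
  size l = size (fsyms ts) ->
  map (tmap f) (refills b0 l ts) = refills c0 (map f l) ts.
Proof. by apply: tmap_refills_aux => t _ l'; apply: tmap_refill. Qed.

Lemma refills_fsyms_aux (B : Type) (a0 : A) (f : A -> B) ts :
  {in ts, forall t, refill a0 (syms t) (tmap f t) = t} ->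
  refills a0 (fsyms ts) (map (tmap f) ts) = ts.
Proof.
rewrite /fsyms; elim: ts => //= t ts IHts IH.
have -> : size (syms (tmap f t)) = size (syms t).
  by rewrite -[RHS]size_nodes -(size_map (fun x => (f x.1, x.2))) -nodes_tmap;
    elim/tree_ind_in: t {IH}
    => //= a us IHu; congr S; rewrite !size_flatten /shape -!map_comp; congr sumn;
      apply/eq_in_map => t /IHu.
rewrite take_size_cat // drop_size_cat // IH ?mem_head // IHts //.
by move=> t' t'ts; apply: IH; rewrite inE t'ts orbT.
Qed.

(** A tree is recovered from its shape and the preorder list of its labels. With the class as [f],
    this is why a skeleton together with the list of pieces loses nothing. *)
Lemma refill_syms (B : Type) (a0 : A) (f : A -> B) t :
  refill a0 (syms t) (tmap f t) = t.
Proof.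
by elim/tree_ind_in: t => // a ts IH; rewrite refill_Node /=; congr Node;
  apply: refills_fsyms_aux.
Qed.

Lemma refills_fsyms (B : Type) (a0 : A) (f : A -> B) ts :
  refills a0 (fsyms ts) (map (tmap f) ts) = ts.
Proof. by apply: refills_fsyms_aux => t _; apply: refill_syms. Qed.

End RefillEq.

(** * Decomposition of a tree into footed pieces *)

Lemma size_leaves_subtree (A V : eqType) (t t' : tree A V) :
  t' \in subtrees t -> size (leaves t') <= size (leaves t).
Proof.
elim/tree_ind_in: t => [v|a ts IH]; first by rewrite inE => /eqP ->.
rewrite inE => /predU1P[->//|/flatten_mapP[t tts /(IH _ tts) le]].
apply: leq_trans le _; rewrite /= size_flatten /shape -map_comp.
case/splitPr: tts => s1 s2; rewrite map_cat sumn_cat /=; lia.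
Qed.

(** When [t'] already contains all leaves of [t], the siblings along the way to it are closed, and
    cutting [t'] out leaves a single hole, marked by [v0]. *)
Lemma subtree_context (A V : eqType) (v0 : V) (t t' : tree A V) :
  t' \in subtrees t -> size (leaves t') = size (leaves t) ->
  0 < size (leaves t) ->
  exists2 c : tree A V, leaves c = [:: v0] & t = lsubst (fun=> t') c.
Proof.
move=> + + t_gt0.
elim/tree_ind_in: t t_gt0 => [v|a ts IH] t_gt0.
  by rewrite inE => /eqP -> _; exists (Leaf v0).
rewrite inE => /predU1P[->|]; first by exists (Leaf v0).
case/flatten_mapP => t tts t't szt'.
have le := size_leaves_subtree t't.
move: t_gt0 szt'; rewrite /= size_flatten /shape -map_comp.
case/splitPr: tts IH => s1 s2 IH; rewrite map_cat sumn_cat /= => t_gt0 szt'.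
have closed s : sumn (map (size \o @leaves A V) s) = 0 ->
    {in s, forall u, leaves u = [::]}.
  elim: s => //= u s IHs /eqP; rewrite addn_eq0 => /andP[/nilP u0 /eqP s0] v.
  by rewrite inE => /predU1P[->//|]; apply: IHs.
have s10 : sumn (map (size \o @leaves A V) s1) = 0 by move: t_gt0 szt' le => /=; lia.
have s20 : sumn (map (size \o @leaves A V) s2) = 0 by move: t_gt0 szt' le => /=; lia.
have [||//||c c0 tc] := IH t; first by rewrite mem_cat mem_head orbT.
- by move: t_gt0 szt' le => /=; lia.
- by move: t_gt0 szt' le => /=; lia.
exists (Node a (s1 ++ c :: s2)).
  rewrite /= map_cat flatten_cat /= c0.
  by rewrite !(_ : forall s, {in s, forall u, leaves u = [::]} ->
       flatten (map (@leaves A V) s) = [::]) //;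
     do ?[exact: closed | elim=> //= u s IHs us; rewrite us ?mem_head // IHs // => v vs;
     apply: us; rewrite inE vs orbT].
rewrite /= map_cat /= -tc; congr (Node a (_ ++ _ :: _));
  by rewrite map_id_in // => u us; apply: lsubst_closed; move: u us; exact: closed.
Qed.

(** By truncation [2 * x - 1] is 0 at 0, and each positive summand loses 1. Every summand being
    below the sum, a nonempty list has at least two positive ones. *)
Lemma sumn_double_pred (ks : seq nat) (k : nat) :
  sumn ks = k -> all (fun x => x < k) ks ->
  sumn [seq 2 * x - 1 | x <- ks] <= 2 * k - 2.
Proof.
have weak s : sumn [seq 2 * x - 1 | x <- s] <= 2 * sumn s - (0 < sumn s).
  elim: s => //= x s; case: (posnP (sumn s)) => [->|h]; case: x => [|x] /=; lia.
elim: ks => //= x ks IH; case: x => [|x] /=; first by rewrite add0n => ks_k /andP[_];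
  apply: IH.
move=> sk /andP[xk _]; have := weak ks; lia.
Qed.

(** Accounting for one child in [size_syms_spine]: [a] is [m], [b] is [#|Sigma|], and the child has
    [s] nodes, a spine of length [q] and [d] variables; for the children after it, [n] counts the
    nodes and [c] the closed trees. *)
Lemma size_step (a b q s d c n n' : nat) :
  s <= a * q + a * b * (2 * d - 2) -> q <= b -> 0 < d -> n <= c + a * b * n' ->
  s + n <= (d == 0) + c + a * b * (2 * d - 1 + n').
Proof.
case: d => // d le qb _ nle; have aqb := leq_mul (leqnn a) qb.
have e : 2 * d.+1 - 1 = (2 * d).+1 by lia.
have e' : 2 * d.+1 - 2 = 2 * d by lia.
rewrite e mulnDr mulnS; rewrite e' in le; lia.
Qed.

Section Decomposition.
Variables (Omega Sigma : ralphabet) (cls : Omega -> Sigma) (m : nat) (c0 : Sigma).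
Hypothesis rk_le : forall a : Omega, rk a <= m.

Definition tclass (p : tree Omega nat) : Sigma :=
  if p is Node a _ then cls a else c0.

Definition is_piece (n : nat) (p : tree Omega nat) : Prop :=
  [/\ pattern n p, isSome (troot p)
    & 0 < n -> exists2 b, is_foot n p b & cls b = tclass p].

(* A decomposition of the tree [gsub id D]: the node labels of D are the pieces. *)
Definition dtree := tree (tree Omega nat) nat.

(** The third condition makes a closed tree a single piece; the last one forbids a descendant that
    could be merged with the node. The bound [m] limits the number of closed children in the size
    estimate. *)
Definition good_node (p : tree Omega nat) (ss : seq dtree) : Prop :=
  [/\ is_piece (size ss) p, size ss <= m,
      leaves (Node p ss) = [::] -> ss = [::]
    & forall p' ss', Node p' ss' \in flatten (map (@subtrees _ _) ss) ->
        tclass p' = tclass p ->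
        size (leaves (Node p' ss')) <> size (leaves (Node p ss))].

Definition good (D : dtree) : Prop :=
  forall p ss, Node p ss \in subtrees D -> good_node p ss.

Lemma good_sub D D' : good D -> D' \in subtrees D -> good D'.
Proof. by move=> gD sub p ss h; apply: gD; apply: subtrees_trans sub. Qed.

Lemma good_Node p ss : good_node p ss -> {in ss, forall D, good D} ->
  good (Node p ss).
Proof.
move=> g gs p' ss'; rewrite inE => /predU1P[[-> ->]//|/flatten_mapP[D Dss]].
exact: gs.
Qed.

Lemma good_hlinear D : good D -> hlinear id D.
Proof.
move=> gD [p n] /nodesP[ss <- /gD[[/andP[_ h] _ _] _ _ _]]; exact: h.
Qed.

(** The root becomes a one-node piece over the decompositions of its children. If a descendant [p']
    conflicts with it, a single merge is enough: the merged piece has the class, the children and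
    the number of variables of [p'], so it inherits the conditions already known for [p']. *)
Lemma dec_exists t : ranked t -> exists2 D : dtree, gsub id D = t & good D.
Proof.
elim/tree_ind_in: t => [v _|a ts IH rt]; first by exists (Leaf v) => // p ss.
have [t0|t_gt0] := posnP (size (leaves (Node a ts))).
  have t0' : leaves (Node a ts) = [::] by apply/nilP/eqP.
  exists (Node (Node a ts) [::]); first exact: lsubst_closed.
  by apply: good_Node => //; split=> //; split=> //; apply/andP; rewrite t0'.
have [ss [tss gss]] : exists ss, map (gsub id) ss = ts /\ {in ss, forall D, good D}.
  move: rt => /= /andP[_]; elim: ts IH {t_gt0} => [|t ts IHts] IH; first by exists [::].
  case/andP => rt rts; have [D Dt gD] := IH t (mem_head _ _) rt.
  have [|ss [sst gss]] := IHts _ rts; first by move=> u uts; apply: IH;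
    rewrite inE uts orbT.
  by exists (D :: ss); split=> /=; [rewrite Dt sst|move=> E; rewrite inE =>
    /predU1P[->|/gss]].
have szss : size ss = size ts by rewrite -tss size_map.
have rka : size ss = rk a by move: rt => /= /andP[/eqP <-].
set p := Node a (map Leaf (iota 0 (size ss))).
have pp : is_piece (size ss) p.
  split=> //=.
    rewrite /pattern /= size_map size_iota rka eqxx all_map /=.
    rewrite (_ : all _ _) /=; last by apply/allP.
    by rewrite -map_comp /=; elim: (iota _ _) => //= i s; rewrite perm_cons.
  by move=> _; exists a => //; rewrite /is_foot rka eqxx /= inE /p rka eqxx.
have glin D : D \in ss -> perm_eq (leaves (gsub id D)) (leaves D).
  by move=> Dss; apply: leaves_gsub; apply: good_hlinear; apply: gss.
have lp : hlinear id (Node p ss).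
  move=> x; rewrite inE => /predU1P[->|]; first by case: pp => /andP[].
  by case/flatten_mapP => D /gss/good_hlinear; apply.
have gp : gsub id (Node p ss) = Node a ts.
  by rewrite /= -tss -[in RHS](map_nth_iota_size (Leaf 0) [seq gsub id i | i <- ss])
    size_map -map_comp.
have szp : size (leaves (Node p ss)) = size (leaves (Node a ts)).
  by rewrite -gp; apply/esym/perm_size/leaves_gsub.
have ssm : size ss <= m by rewrite rka.
case: (boolP (has (fun D : dtree => if D is Node p' ss' then (tclass p' == cls a) &&
   (size (leaves D) == size (leaves (Node p ss))) else false)
   (flatten (map (@subtrees _ _) ss)))) => [/hasP[]|/hasPn noconf]; last first.
  exists (Node p ss) => //; apply: good_Node => //; split=> //.
    by move=> l0; move: t_gt0; rewrite -szp l0.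
  by move=> p' ss' /noconf /=; rewrite /tclass /=; case: eqP => //= -> /eqP.
(* The node p' repeats class and number of variables of the root: everything
   from the root down to p' is merged into a single piece with foot that of p'. *)
case=> // p' ss' sub /andP[/eqP cl /eqP sz].
have sub' : Node p' ss' \in subtrees (Node p ss) by rewrite inE sub orbT.
have g' : good_node p' ss'.
  by case/flatten_mapP: sub => D /gss; apply.
have [|c cl0 pc] := subtree_context 0 sub' sz; first by rewrite szp.
have lc : hlinear id c.
  move=> [q n] qn.
  have: (q, n) \in nodes (Node p ss).
    by rewrite pc (perm_mem (nodes_lsubst _ _)) mem_cat qn.
  exact: lp.
set e := gsub id c.
have le : leaves e = [:: 0].
  by apply/perm_small_eq => //; rewrite -cl0; apply: leaves_gsub.
have [[pat' nod' foot'] ss'm ss'0 nc'] := g'.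
exists (Node (lsubst (fun=> p') e) ss').
  rewrite /= lsubst_comp -[RHS]gp pc gsub_lsubst //.
(* The context [c] is either the bare hole or has root [p], whose class is that of [p']. *)
have clP : tclass (lsubst (fun=> p') e) = tclass p'.
  rewrite /e; case: (c) pc => [i|q cs] //= [<- _] /=; by rewrite cl.
apply: good_Node; last first.
  move=> D Dss'; apply: good_sub (_ : good (Node p' ss')) _ => //.
    by case/flatten_mapP: sub => D' /gss g'' s; apply: good_sub s.
  by apply: subtrees_child Dss' (subtrees_refl _).
split=> //; last by move=> q us h; rewrite clP; apply: nc'.
split=> //.
- rewrite /pattern leaves_lsubst le /= cats0.
  move: pat' => /andP[rp' ->]; rewrite andbT rankedE.
  rewrite (perm_all _ (nodes_lsubst _ _)) all_cat le /= cats0 -!rankedE rp' andbT.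
  rewrite /e rankedE (perm_all _ (nodes_gsub lc)).
  rewrite -all_map_flatten; apply/allP => -[q n] qn /=.
  rewrite -rankedE.
  have: (q, n) \in nodes (Node p ss).
    by rewrite pc (perm_mem (nodes_lsubst _ _)) mem_cat qn.
  rewrite inE => /predU1P[[-> _]|]; first by case: pp => /andP[].
  case/flatten_mapP => D /gss gD /nodesP[us _ /gD].
  by case=> -[/andP[]].
- by rewrite /e; case: (c) pc => [i|q cs] //= [<- _].
- move=> /foot'[b /andP[rb fb] cb]; exists b; last by rewrite clP.
  by rewrite /is_foot rb /=; apply: (subtrees_lsubst (v := 0)) => //; rewrite le.
Qed.

(* The classes of the nodes of D with k variables below them; if D has k > 0
   variables, these nodes form a path, and in a good D their classes differ. *)
Definition spine (k : nat) (D : dtree) : seq Sigma :=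
  [seq if t is Node p _ then tclass p else c0
  | t <- subtrees D & (if t is Node _ _ then true else false) &&
                      (size (leaves t) == k)].

Lemma spine_lt k D : size (leaves D) < k -> spine k D = [::].
Proof.
move=> lt; rewrite /spine (_ : filter _ _ = [::]) //.
apply/eqP; rewrite -[_ == _]negbK -has_filter; apply/hasPn => t /size_leaves_subtree le.
by rewrite negb_and orbC ltn_eqF // (leq_ltn_trans le).
Qed.

Lemma spine_Node k p ss : size (leaves (Node p ss)) = k ->
  spine k (Node p ss) = tclass p :: flatten (map (spine k) ss).
Proof.
move=> sz; rewrite /spine [subtrees _]/= [filter _ _]/= sz eqxx /=; congr cons.
by rewrite filter_flatten map_flatten -!map_comp.
Qed.

(* For k > 0 the compressed tree of a tree with k variables has at most 2k-1
   paths, each with at most #|Sigma| nodes, and each node has less than m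
   children without variables. *)
Definition max_pieces (k : nat) : nat :=
  if k is 0 then 1 else m * #|Sigma| * (2 * k - 1).

Lemma good_closed D : good D -> leaves D = [::] -> size (syms D) = 1.
Proof.
case: D => // p ss gD l0.
by have [_ _ /(_ l0) -> _] := gD p ss (subtrees_refl _).
Qed.

(** If some child keeps all k variables, its spine is extended by the class of the root, which is
    new by the last condition of [good_node], and the other children are closed. Otherwise the spine
    stops here, and the children share the variables with fewer than k each, which is the case of
    [sumn_double_pred]. *)
Lemma size_syms_spine D : good D -> 0 < size (leaves D) ->
  uniq (spine (size (leaves D)) D) /\
  size (syms D) <= m * size (spine (size (leaves D)) D) +
                   m * #|Sigma| * (2 * size (leaves D) - 2).
Proof.
elim/tree_ind_in: D => [v|p ss IH] gD k_gt0 //.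
have gss : {in ss, forall D, good D}.
  by move=> D Dss; apply: good_sub gD _; apply: subtrees_child Dss (subtrees_refl _).
have [_ szm _ nc] := gD p ss (subtrees_refl _).
rewrite spine_Node //; set k := size (leaves (Node p ss)) in nc k_gt0 *.
have kE : k = sumn [seq size (leaves D) | D <- ss].
  by rewrite /k /= size_flatten /shape -map_comp.
case: (boolP (has (fun D => size (leaves D) == k) ss)) =>
  [/hasP[D Dss /eqP Dk]|/hasPn small].
  have gD' := gss _ Dss.
  have [uD leD] := IH D Dss gD' (eq_ind_r (fun n => 0 < n) k_gt0 Dk).
  rewrite Dk in uD leD.
  have notin : tclass p \notin spine k D.
    apply/mapP => -[t]; rewrite mem_filter => /andP[/andP[]].
    case: t => // q us _ /eqP usk sub /esym eq.
    by apply: nc eq usk; apply/flatten_mapP; exists D.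
  case/splitPr: Dss kE szm gss {IH nc} => s1 s2.
  rewrite map_cat sumn_cat /= Dk => kE szm gss.
  have closed (s : seq dtree) : {in s, forall E, good E} ->
    sumn [seq size (leaves D) | D <- s] = 0 ->
      sumn [seq size (syms E) | E <- s] = size s /\ flatten (map (spine k) s) = [::].
    elim: s => //= E s IHs gs /eqP; rewrite addn_eq0 => /andP[/nilP E0 /eqP s0].
    have [|-> ->] := IHs _ s0; first by move=> F Fs; apply: gs; rewrite inE Fs orbT.
    by rewrite good_closed // ?spine_lt ?E0 //; apply: gs; rewrite mem_head.
  have /eqP : sumn [seq size (leaves D) | D <- s1] + sumn [seq size (leaves D) | D <-
    s2] = 0.
    by apply/eqP; rewrite -(eqn_add2l k) addn0 addnCA -kE.
  rewrite addn_eq0 => /andP[/eqP z1 /eqP z2].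
  have [|n1 f1] := closed s1 _ z1; first by move=> E Es; apply: gss; rewrite mem_cat Es.
  have [|n2 f2] := closed s2 _ z2.
    by move=> E Es; apply: gss; rewrite mem_cat inE Es !orbT.
  have -> : flatten (map (spine k) (s1 ++ D :: s2)) = spine k D.
    by rewrite map_cat flatten_cat /= f1 f2 cats0.
  rewrite /= notin uD; split=> //.
  rewrite size_flatten /shape -map_comp map_cat sumn_cat /= n1 n2.
  (* The root and the siblings of [D] together cost at most [m], the share of the new spine
     entry. *)
  move: szm; rewrite size_cat /= => szm; apply: leq_trans (_ : size s1 + size s2 + 1 +
      size (syms D) <= _); first
        by rewrite addn1 addSn ltnS -addnA [size (syms D) + _]addnC.
  apply: leq_trans (leq_add (leqnn _) leD) _.
  by rewrite addnA leq_add2r mulnS leq_add2r addn1 -addnS.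
have small' : all (fun x => x < k) [seq size (leaves D) | D <- ss].
  rewrite all_map; apply/allP => D Dss /=; rewrite ltn_neqAle small //=.
  by apply: size_leaves_subtree; apply: subtrees_child Dss (subtrees_refl _).
have -> : flatten (map (spine k) ss) = [::].
  elim: (ss) small' => //= D s IHs /andP[Dk /IHs ->]; by rewrite spine_lt.
split=> //=; rewrite muln1.
have dp := sumn_double_pred (esym kE) small'.
have le : sumn [seq size (syms D) | D <- ss] <=
   count (fun D => size (leaves D) == 0) ss +
   m * #|Sigma| * sumn [seq 2 * x - 1 | x <- [seq size (leaves D) | D <- ss]].
  elim: (ss) gss IH => //= D s IHs gs IH.
  have {}IHs := IHs (fun E Es => gs E (@mem_behead _ (D :: s) E Es)) (fun E Es =>
    IH E (@mem_behead _ (D :: s) E Es)).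
  have gD' := gs _ (mem_head _ _).
  case: posnP => [/eqP/nilP D0|D_gt0].
    by rewrite good_closed // D0 /= add0n -addnA leq_add2l.
  have [uD leD] := IH D (mem_head _ _) gD' D_gt0.
  have := uniq_leq_size uD (fun x _ => mem_enum Sigma x).
  rewrite -cardE => card; by have := size_step leD card D_gt0 IHs;
    rewrite eqn0Ngt D_gt0.
(* Some child has variables, so at most [m - 1] children are closed, which leaves room for the
   root. *)
have lt : count (fun D => size (leaves D) == 0) ss < size ss.
  rewrite ltn_neqAle count_size andbT -all_count; apply/negP => /allP all0.
  move: k_gt0; rewrite kE (_ : map _ _ = map (fun=> 0) ss).
    by elim: (ss) => //= ? ? ->.
  by apply/eq_in_map => E /all0/eqP.
rewrite size_flatten /shape -map_comp; apply: leq_ltn_trans le _.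
apply: (@leq_trans (size ss + m * #|Sigma| * (2 * k - 2))); last by rewrite leq_add2r.
by rewrite -addSn; apply: leq_add => //; rewrite leq_mul2l dp orbT.
Qed.

Lemma good_size D : good D -> size (syms D) <= max_pieces (size (leaves D)).
Proof.
move=> gD; have [k0|k_gt0] := posnP (size (leaves D)).
  by rewrite good_closed // ?k0 //; apply: size0nil.
have [u le] := size_syms_spine gD k_gt0.
have := uniq_leq_size u (fun x _ => mem_enum Sigma x).
rewrite -cardE => card; have := @size_step _ _ _ _ _ 0 0 0 le card k_gt0 (leq0n _).
by rewrite !addn0 eqn0Ngt k_gt0 add0n /max_pieces; case: (size (leaves D)) k_gt0.
Qed.

End Decomposition.

(** * Pairing and lookup in concatenated lists *)

Lemma in_zip (T X : eqType) (s : seq T) (u : seq X) x y :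
  (x, y) \in zip s u -> x \in s /\ y \in u.
Proof.
elim: s u => [|a s IH] [|b u] //=; rewrite !inE => /predU1P[[-> ->]|/IH[-> ->]].
  by rewrite !eqxx.
by rewrite !orbT.
Qed.

Lemma all2_cat (T X : Type) (r : T -> X -> bool) s1 s2 u1 u2 :
  size s1 = size u1 ->
  all2 r (s1 ++ s2) (u1 ++ u2) = all2 r s1 u1 && all2 r s2 u2.
Proof. by elim: s1 u1 => [|x s1 IH] [|y u1] //= [/IH->]; rewrite andbA. Qed.

Lemma all2_size (T X : Type) (r : T -> X -> bool) s u :
  all2 r s u -> size s = size u.
Proof. by rewrite all2E => /andP[/eqP]. Qed.

Lemma perm_refl_eq (T : eqType) (s t : seq T) : s = t -> perm_eq s t.
Proof. by move->. Qed.

Lemma in_zip_zip (T X Y : eqType) (s : seq T) (u : seq X) (v : seq Y) x y z :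
  (x, y, z) \in zip (zip s u) v -> (x, z) \in zip s v.
Proof.
elim: s u v => [|a s IH] [|b u] [|c v] //=; rewrite !inE => /predU1P[[-> _ ->]|/IH ->].
  by rewrite eqxx.
by rewrite orbT.
Qed.

Lemma nth_index_flatten (T X : eqType) (x0 : X) (Bs : seq (seq T))
    (us : seq (seq X)) B u C :
  uniq (flatten Bs) -> map size Bs = map size us -> (B, u) \in zip Bs us ->
  C \in B -> nth x0 (flatten us) (index C (flatten Bs)) = nth x0 u (index C B).
Proof.
elim: Bs us => [|B0 Bs IH] [|u0 us] //=; rewrite cat_uniq => /and3P[_ dis un].
case=> sz0 sz; rewrite inE => /predU1P[[-> ->]|Bu] CB.
  by rewrite index_cat CB nth_cat -sz0 index_mem CB.
have CBs : C \in flatten Bs.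
  by apply/flattenP; exists B => //; case: (in_zip Bu).
rewrite index_cat ifN; last by apply: contra dis => C0; apply/hasP; exists C.
by rewrite nth_cat -sz0 ltnNge leq_addr /= addKn; apply: IH.
Qed.

Lemma map_nth_index (T : eqType) (X : Type) (x0 : X) (s : seq T) (u : seq X) :
  uniq s -> size s = size u -> [seq nth x0 u (index C s) | C <- s] = u.
Proof.
move=> us sz; apply: (@eq_from_nth _ x0); first by rewrite size_map.
move=> i; rewrite size_map => ilt; case: s us sz ilt => // C0 s us sz ilt.
by rewrite (nth_map C0) // index_uniq.
Qed.

(** * Finiteness and environments *)

Section Enumeration.
Variable T : eqType.

Fixpoint seqs (l : seq T) (n : nat) : seq (seq T) :=
  if n is n'.+1 then [seq x :: s | x <- l, s <- seqs l n'] else [:: [::]].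

Lemma mem_seqs l s : {subset s <= l} -> s \in seqs l (size s).
Proof.
elim: s => //= x s IH sub; apply/allpairsP; exists (x, s) => /=; split=> //.
  by apply: sub; rewrite mem_head.
by apply: IH => y ys; apply: sub; rewrite inE ys orbT.
Qed.

Definition seqs_upto (l : seq T) (m : nat) : seq (seq T) :=
  flatten [seq seqs l n | n <- iota 0 m.+1].

End Enumeration.

Fixpoint bounded_trees (A : finType) (lv : seq nat) (m d : nat) : seq (tree A nat) :=
  if d is d'.+1 then
    map Leaf lv ++
    [seq Node a ts | a <- enum A, ts <- seqs_upto (bounded_trees A lv m d') m]
  else [::].

Lemma bounded_treesS (A : finType) lv m d :
  bounded_trees A lv m d.+1 = map Leaf lv ++
    [seq Node a ts | a <- enum A, ts <- seqs_upto (bounded_trees A lv m d) m].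
Proof. by []. Qed.

Arguments bounded_trees : simpl never.

Lemma mem_bounded_trees (A : finType) lv m d (t : tree A nat) :
  {subset leaves t <= lv} -> size (syms t) < d -> all (fun x => x.2 <= m) (nodes t) ->
  t \in bounded_trees A lv m d.
Proof.
elim/tree_ind_in: t d => [i|a ts IH] [//|d] sub lt ar;
  rewrite bounded_treesS mem_cat.
  by rewrite map_f // sub ?mem_head.
apply/orP; right; apply: (allpairs_f (@Node A nat)); first by rewrite mem_enum.
move: ar => /= /andP[szm ar]; apply/flatten_mapP; exists (size ts).
  by rewrite mem_iota.
apply: mem_seqs => t tts; apply: IH => //.
- by move=> i it; apply: sub; apply/flatten_mapP; exists t.
- rewrite -ltnS; apply: leq_ltn_trans lt; rewrite /= ltnS size_flatten /shape -map_comp.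
  by case/splitPr: tts => s1 s2; rewrite map_cat sumn_cat /=; lia.
- by move: ar; rewrite -all_map_flatten => /allP/(_ _ tts).
Qed.

Section Environments.
Variables (N Sigma X : ralphabet) (lift : Sigma -> X).

(** This environment makes [tsubst] an instance of [gsub] on ranked trees ([tsubstE]), so that the
    composition law applies. A terminal is replaced by itself over its variables, retyped by
    [lift]. *)
Definition henv (s : seq N) (u : seq (tree X nat)) (x : sumA N Sigma) : tree X nat :=
  match x with
  | inl C => nth (Leaf 0) u (index C s)
  | inr a => Node (lift a) (map Leaf (iota 0 (rk a)))
  end.

Hypothesis rk_lift : forall a, rk (lift a) = rk a.

Lemma pattern_lift a : pattern (rk a) (Node (lift a) (map Leaf (iota 0 (rk a))) :
  tree X nat).
Proof.
rewrite /pattern /= size_map size_iota rk_lift eqxx all_map /=.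
rewrite (_ : all _ _) /=; last by apply/allP.
by rewrite -map_comp /=; elim: (iota _ _) => //= i s; rewrite perm_cons.
Qed.

Definition typed (s : seq N) (u : seq (tree X nat)) :=
  all2 (fun C t => pattern (rk C) t) s u.

Lemma pattern_henv s u n (x : sumA N Sigma) : typed s u ->
  (if x is inl C then C \in s else true) -> n = rk x -> pattern n (henv s u x).
Proof.
case: x => [C|a] ty Cs ->; last exact: pattern_lift.
elim: s u ty Cs => [|C' s IH] [|t u] //= /andP[pt ty].
by rewrite inE eq_sym; case: eqP => [<-//|_] /=; apply: IH.
Qed.

End Environments.

Definition getN (N Sigma : Type) (x : N + Sigma) : option N :=
  if x is inl C then Some C else None.

Lemma occNE (N Sigma : Type) (u : seq (tree (N + Sigma) nat)) :
  occN u = pmap (@getN N Sigma) (fsyms u).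
Proof. by []. Qed.

Lemma pattern_gsub (X Y : ralphabet) (h : X -> tree Y nat) k t :
  pattern k t -> {in nodes t, forall x, pattern x.2 (h x.1)} ->
  pattern k (gsub h t).
Proof.
move=> /andP[rt lt] ht.
have hl : hlinear h t by move=> x /ht /andP[].
apply/andP; split; last exact: perm_trans (leaves_gsub hl) lt.
rewrite rankedE (perm_all _ (nodes_gsub hl)) -all_map_flatten; apply/allP => x /ht.
by rewrite -rankedE => /andP[].
Qed.

Lemma tsubstE (N Sigma : ralphabet) (s : seq N) (u : seq (tree Sigma nat))
    (t : tree (sumA N Sigma) nat) :
  ranked t -> tsubst s u t = gsub (henv id s u) t.
Proof.
elim/tree_ind_in: t => // -[C|a] ts IH /= /andP[/eqP sz rts].
  congr (lsubst (nth _ _) _); apply/eq_in_map => t tts; apply: IH => //.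
  exact: (allP rts).
congr Node; rewrite -map_comp -sz -(size_map (gsub (henv id s u)))
  [RHS](map_nth_iota_size (Leaf 0)).
by apply/eq_in_map => t tts; apply: IH => //; apply: (allP rts).
Qed.

Lemma eq_tsubst (N Sigma : ralphabet) (s s' : seq N) (u u' : seq (tree Sigma nat))
    (t : tree (sumA N Sigma) nat) :
  ranked t ->
  {in pmap (@getN N Sigma) (syms t), forall C,
     nth (Leaf 0) u (index C s) = nth (Leaf 0) u' (index C s')} ->
  tsubst s u t = tsubst s' u' t.
Proof.
move=> rt eqn; rewrite !tsubstE //; apply: eq_in_gsub => -[[C|a] n] //= xt.
apply: eqn; rewrite mem_pmap symsE -map_comp; apply/mapP; exists (inl C, n) => //.
Qed.

Lemma pmap_flatten (T U : Type) (f : T -> option U) (ss : seq (seq T)) :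
  pmap f (flatten ss) = flatten (map (pmap f) ss).
Proof. by elim: ss => //= s ss <-; rewrite pmap_cat. Qed.

Lemma flatten_pmap_getN (N Sigma : Type) (T : Type) (F : N + Sigma -> seq T) u :
  (forall a, F (inr a) = [::]) ->
  flatten (map F u) = flatten [seq F (inl C) | C <- pmap (@getN N Sigma) u].
Proof. by move=> F0; elim: u => //= -[C|a] u /= ->; rewrite ?F0. Qed.

Lemma uniq_flatten_map (T U : eqType) (f : T -> seq U) (s : seq T) :
  uniq s -> {in s, forall x, uniq (f x)} ->
  {in s &, forall x y z, z \in f x -> z \in f y -> x = y} -> uniq (flatten (map f s)).
Proof.
elim: s => //= x s IH /andP[xs us] uf dis; rewrite cat_uniq uf ?mem_head //=.
apply/andP; split; last first.
  apply: IH => // [y h|y z h h']; first by apply: uf; rewrite inE h orbT.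
  by apply: dis; rewrite inE ?h ?h' orbT.
apply/hasPn => z /flatten_mapP[y ys zy]; apply/negP => /= zx.
by move: xs; rewrite (dis x y _ _ z) ?mem_head ?inE ?ys ?orbT.
Qed.

Lemma valid_links_uniq (N Sigma : ralphabet) (bigN : seq (seq N)) (r : rule N Sigma) :
  {in bigN, forall B, uniq B} -> valid_rule bigN r -> uniq (flatten (links r)).
Proof.
move=> uB [_ [ul sub dis _]]; rewrite -[links r]map_id; apply: uniq_flatten_map =>
  // [B Br|B B' Br B'r x xB xB'].
  by apply/uB/sub.
by case: (eqVneq B B') => // /(dis B B' Br B'r)/disjointFr/(_ xB); rewrite xB'.
Qed.

Lemma valid_occN_perm (N Sigma : ralphabet) (bigN : seq (seq N)) (r : rule N Sigma) :
  {in bigN, forall B, uniq B} -> valid_rule bigN r ->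
  perm_eq (occN (rhs r)) (flatten (links r)).
Proof.
move=> uB vr; have ul := valid_links_uniq uB vr.
case: vr => -[_ _ uo] [_ _ _ eqi]; apply: uniq_perm => // x; by rewrite eqi.
Qed.

Lemma rk_mr (Omega : ralphabet) (a : Omega) : rk a <= mr Omega.
Proof. exact: leq_bigmax. Qed.

Lemma mem_occT (X Y : eqType) (u : seq (tree (X + Y) nat)) a :
  (a \in occT u) = (inr a \in fsyms u).
Proof.
rewrite /occT mem_pmap; apply/mapP/idP => [[[//|b] h [->]] //|h].
by exists (inr a).
Qed.

Lemma ranked_regular (Omega : ralphabet) : regular (fun t : tree Omega void =>
  ranked t).
Proof. by exists unit, (fun _ _ => tt), [set: unit] => t; rewrite inE;
  split=> [|[]]. Qed.

Lemma leaves_void (A : eqType) (t : tree A void) : leaves t = [::].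
Proof. by case: (leaves t) => // -[]. Qed.

Lemma ranked_lsubst (Omega : ralphabet) (V W : eqType) (g : V -> tree Omega W) t :
  ranked t -> {in leaves t, forall v, ranked (g v)} -> ranked (lsubst g t).
Proof.
move=> rt rg; rewrite rankedE (perm_all _ (nodes_lsubst g t)) all_cat -rankedE rt /=.
by rewrite -all_map_flatten; apply/allP => v /rg; rewrite rankedE.
Qed.

Lemma onth_nth (T : Type) (x0 : T) (s : seq T) i x : onth s i = Some x ->
  nth x0 s i = x /\ i < size s.
Proof. by elim: s i => [|y s IH] [|i] //= => [[->]|/IH]. Qed.

(** * The grammar of pieces *)

Section Construction.
Variables (Sigma : ralphabet) (G : mcftg Sigma) (c0 : Sigma).

Let N := nt G.
Let m := mr Sigma.

Definition skeleton := tree Sigma nat.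

Definition ok_skel (C : N) (s : skeleton) : bool :=
  [&& perm_eq (leaves s) (iota 0 (rk C)),
      size (syms s) <= max_pieces Sigma m (rk C)
    & all (fun x => x.2 <= m) (nodes s)].

Definition skel_state : choiceType := (seq N * seq skeleton)%type.

Definition max_tree_size : nat :=
  (\max_(k < (width G).+1) max_pieces Sigma m k).+1.

Definition skel_states : seq skel_state :=
  [seq q <- [seq (A, s) | A <- bign G,
     s <- seqs (bounded_trees Sigma (iota 0 (width G)) m max_tree_size) (size A)]
  | all2 ok_skel q.1 q.2].

Lemma mem_skel_states q :
  (q \in skel_states) = (q.1 \in bign G) && all2 ok_skel q.1 q.2.
Proof.
rewrite mem_filter andbC; case: (boolP (all2 _ _ _)) => ok; rewrite ?andbF ?andbT //.
apply/idP/idP; first by case/allpairsPdep => A [s [/= AG _ ->]].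
case: q ok => A s /= ok AG; apply/allpairsPdep; exists A, s; split=> //.
have sz : size A = size s by apply/eqP; move: ok; rewrite all2E => /andP[].
rewrite sz; apply: mem_seqs => t ts.
have [C CA okt] : exists2 C, C \in A & ok_skel C t.
  elim: (A) (s) ok ts => [|C A' IH] [|t' s'] //= /andP[okC ok'].
  rewrite inE => /predU1P[->|]; first by exists C; rewrite ?mem_head.
  by case/(IH _ ok') => C' CA' ?; exists C' => //; rewrite inE CA' orbT.
case/and3P: okt => pl sz_t ar; apply: mem_bounded_trees => //.
  by move=> i; rewrite (perm_mem pl) !mem_iota !add0n /= => /leq_trans; apply;
    apply: rk_mr.
rewrite ltnS; apply: leq_trans sz_t _.
have lt : rk C < (width G).+1 by rewrite ltnS; apply: rk_mr.
exact: (@leq_bigmax _ (fun k : 'I_(width G).+1 => max_pieces Sigma m k) (Ordinal lt)).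
Qed.

Definition labelT : choiceType := (skel_state * nat)%type.

Definition all_labels : seq labelT :=
  [seq (q, i) | q <- skel_states, i <- iota 0 (size (fsyms q.2))].

Definition nt_info (x : option (seq_sub all_labels)) : Sigma * nat :=
  if x is Some y then nth (c0, 0) (fnodes (ssval y).1.2) (ssval y).2 else (c0, 0).

(* [None] is the initial nonterminal and [Some (q, i)] is the i-th node, in
   preorder, of the forest of skeletons of the state q; its class and rank are
   the symbol and the number of children of that node. *)
Definition tag_nt : ralphabet :=
  @RAlphabet (option (seq_sub all_labels)) (fun x => (nt_info x).2).

(* Junk value [None] if q is not a state or has at most i nodes. *)
Definition mk_nt (q : skel_state) (i : nat) : tag_nt := insub (q, i).

Definition labels (q : skel_state) : seq tag_nt :=
  [seq mk_nt q i | i <- iota 0 (size (fsyms q.2))].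

Lemma size_labels q : size (labels q) = size (fsyms q.2).
Proof. by rewrite size_map size_iota. Qed.

Lemma mem_all_labels q i :
  q \in skel_states -> i < size (fsyms q.2) -> (q, i) \in all_labels.
Proof.
by move=> qS ilt; apply/allpairsPdep; exists q, i; rewrite mem_iota.
Qed.

Lemma mk_ntP q i : q \in skel_states -> i < size (fsyms q.2) ->
  exists2 y : seq_sub all_labels, mk_nt q i = Some y & ssval y = (q, i).
Proof.
move=> qS ilt; have h := mem_all_labels qS ilt.
by exists (SeqSub h) => //; rewrite /mk_nt insubT.
Qed.

Lemma labels_info q : q \in skel_states ->
  [seq nt_info x | x <- labels q] = fnodes q.2.
Proof.
move=> qS; rewrite -[RHS](map_nth_iota_size (c0, 0)) /labels -map_comp size_fnodes.
apply/eq_in_map => i; rewrite mem_iota add0n /= => ilt.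
by have [y /= -> /= ->] := mk_ntP qS ilt.
Qed.

Lemma labelsP q x : q \in skel_states -> x \in labels q ->
  exists y : seq_sub all_labels, x = Some y /\ (ssval y).1 = q.
Proof.
move=> qS /mapP[i]; rewrite mem_iota add0n /= => ilt ->.
by have [y -> ey] := mk_ntP qS ilt; exists y; rewrite ey.
Qed.

Lemma labels_uniq q : q \in skel_states -> uniq (labels q).
Proof.
move=> qS; rewrite map_inj_in_uniq ?iota_uniq // => i j.
rewrite !mem_iota !add0n /= => ilt jlt.
have [y -> ey] := mk_ntP qS ilt; have [y' -> ey'] := mk_ntP qS jlt.
by case=> yy'; move: ey; rewrite yy' ey' => -[->].
Qed.

Lemma labels_disjoint q q' x : q \in skel_states -> q' \in skel_states ->
  x \in labels q -> x \in labels q' -> q = q'.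
Proof. by move=> qS q'S /(labelsP qS)[y [-> <-]] /(labelsP q'S)[y' [[<-] <-]]. Qed.

Lemma labels_None q : q \in skel_states -> None \notin labels q.
Proof. by move=> qS; apply/negP => /(labelsP qS)[y []]. Qed.

Definition tag_alphabet : ralphabet := sumA tag_nt Sigma.

Definition tag_class (x : tag_alphabet) : Sigma :=
  match x with inl y => (nt_info y).1 | inr a => a end.

(** [dec_exists] asks for symbols of rank at most [m]. The rank of a label is the number of children
    of a skeleton node, which [ok_skel] bounds for this purpose. *)
Lemma tag_rk (x : tag_alphabet) : rk x <= m.
Proof.
case: x => [[y|]|a] //=; last exact: rk_mr.
case: y => -[q i] /= yL; case/allpairsPdep: yL => q' [i' [qS _ [-> _]]].
move: qS; rewrite mem_skel_states => /andP[_ ok].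
case: (ltnP i (size (fnodes q'.2))) => [ilt|?]; last by rewrite nth_default.
have: nth (c0, 0) (fnodes q'.2) i \in fnodes q'.2 by apply: mem_nth.
case/flatten_mapP => s ss; move: (nth _ _ _) => x.
apply/(allP (a := fun x : Sigma * nat => x.2 <= m)).
elim: (q'.1) (q'.2) ok ss => [|C A IH] [|t u] //= /andP[/and3P[_ _ ar] ok].
by rewrite inE => /predU1P[->|] //; apply: IH.
Qed.

Notation tclassT := (tclass tag_class c0).
Notation goodT := (good tag_class m c0).

(** Rankedness stands under the existential quantifier so that choice yields a total function
    [dec]. *)
Lemma dec_total (t : tree tag_alphabet nat) :
  exists D : dtree tag_alphabet, ranked t -> gsub id D = t /\ goodT D.
Proof.
have [rt|] := boolP (ranked t); last by exists (Leaf 0).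
by have [D Dt gD] := dec_exists tag_class c0 tag_rk rt; exists D.
Qed.

Definition dec (t : tree tag_alphabet nat) : dtree tag_alphabet :=
  projT1 (cid (dec_total t)).

Lemma decK t : ranked t -> gsub id (dec t) = t.
Proof. by move=> rt; have [] := projT2 (cid (dec_total t)) rt. Qed.

Lemma dec_good t : ranked t -> goodT (dec t).
Proof. by move=> rt; have [] := projT2 (cid (dec_total t)) rt. Qed.

Definition labelled (q : skel_state) : seq (tree tag_alphabet nat) :=
  refills (inr c0 : tag_alphabet) [seq (inl x : tag_alphabet) | x <- labels q] q.2.

Definition expand (r : rule N Sigma) (ss : seq (seq skeleton)) :
    seq (tree tag_alphabet nat) :=
  map (gsub (henv (inr : Sigma -> tag_alphabet) (flatten (links r))
              (flatten (map labelled (zip (links r) ss))))) (rhs r).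

Definition skel (r : rule N Sigma) (ss : seq (seq skeleton)) : seq skeleton :=
  map (tmap tclassT) (map dec (expand r ss)).

Definition pieces (r : rule N Sigma) (ss : seq (seq skeleton)) :
    seq (tree tag_alphabet nat) := fsyms (map dec (expand r ss)).

Definition ok_choice (r : rule N Sigma) (ss : seq (seq skeleton)) : Prop :=
  [/\ r \in rules G, size ss = size (links r)
    & {in zip (links r) ss, forall q, q \in skel_states}].

(** Labels and skeletons are read off the same list [fnodes], so each node receives a label whose
    rank is its number of children. *)
Lemma labelled_typed q : q \in skel_states -> typed q.1 (labelled q).
Proof.
case: q => A s qS; have info := labels_info qS; have szl := size_labels (A, s).
move: qS; rewrite mem_skel_states => /andP[_ ok]; move: ok info szl;
  rewrite /labelled /=.
move: (labels (A, s)) => ls.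
elim: A s ls => [|C A IH] [|t s] ls //= /andP[okt ok] info szl.
have szl' : size ls = size (syms t) + size (fsyms s) by rewrite szl /fsyms /= size_cat.
have i1 : map nt_info (take (size (syms t)) ls) = nodes t.
  by rewrite map_take info /fnodes /= take_size_cat // size_nodes.
have i2 : map nt_info (drop (size (syms t)) ls) = fnodes s.
  by rewrite map_drop info /fnodes /= drop_size_cat // size_nodes.
apply/andP; split; last first.
  by rewrite -map_drop; apply: IH => //; rewrite size_drop szl' addKn.
have szt : size (take (size (syms t)) ls) = size (syms t).
  by rewrite -(size_map nt_info) i1 size_nodes.
rewrite -map_take; apply/andP; split; last by rewrite leaves_refill; case/and3P: okt.
rewrite rankedE nodes_refill ?size_map // -i1 /unzip2 -map_comp.
by elim: (take _ _) => //= x l ->; rewrite eqxx.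
Qed.

Lemma typed_flatten r ss : ok_choice r ss ->
  typed (flatten (links r)) (flatten (map labelled (zip (links r) ss))).
Proof.
case=> _; elim: (links r) ss => [|B Bs IH] [|s ss] //= [sz] qS.
have q0 := labelled_typed (qS _ (mem_head _ _)).
rewrite /typed all2_cat ?(all2_size q0) //; apply/andP; split=> //.
by apply: IH => // q qz; apply: qS; rewrite inE qz orbT.
Qed.

Lemma bign_uniq : {in bign G, forall B, uniq B}.
Proof. by move=> B /mc_bign[]. Qed.

Lemma links_uniq r : r \in rules G -> uniq (flatten (links r)).
Proof. by move/mc_rules; apply: valid_links_uniq; apply: bign_uniq. Qed.

Lemma rhs_ranked r t : r \in rules G -> t \in rhs r -> @ranked (sumA N Sigma) _ t.
Proof.
move=> /mc_rules[[_ + _] _]; elim: (lhs r) (rhs r) => [|C A IH] [|u us] //=.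
by case/andP=> /andP[ru _] /IH{}IH; rewrite inE => /predU1P[->//|/IH].
Qed.

Lemma henv_nodes (X : ralphabet) (lift : Sigma -> X) u r t :
  (forall a, rk (lift a) = rk a) -> r \in rules G -> typed (flatten (links r)) u ->
  t \in rhs r ->
  {in nodes t, forall x, pattern x.2 (henv lift (flatten (links r)) u x.1)}.
Proof.
move=> rkl rG ty tr [x n] xt /=; apply: pattern_henv => //; last first.
  by have /= := rhs_ranked rG tr; rewrite rankedE => /allP/(_ _ xt)/eqP.
case: x xt => // C Ct.
have [_ [_ _ _ ->]] := mc_rules rG.
rewrite occNE mem_pmap; apply/mapP; exists (inl C) => //.
apply/flatten_mapP; exists t => //; rewrite symsE; apply/mapP; exists (inl C, n) => //.
Qed.

(** * Cutting the right-hand side of one rule *)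

Section Choice.
Variables (r : rule N Sigma) (ss : seq (seq skeleton)).
Hypothesis ok : ok_choice r ss.

Let env := henv (inr : Sigma -> tag_alphabet) (flatten (links r))
              (flatten (map labelled (zip (links r) ss))).

Lemma env_nodes t : t \in rhs r -> {in nodes t, forall x, pattern x.2 (env x.1)}.
Proof.
have [rG _ _] := ok; move=> tr; apply: henv_nodes => //; exact: typed_flatten.
Qed.

Lemma env_hlinear t : t \in rhs r -> hlinear env t.
Proof. by move=> /env_nodes ht x /ht /andP[]. Qed.

Lemma expand_typed : typed (lhs r) (expand r ss).
Proof.
have [rG _ _] := ok; have [[_ + _] _] := mc_rules rG.
have: {subset rhs r <= rhs r} by []; rewrite /expand -/env.
elim: {1 3 4}(rhs r) (lhs r) => [|t ts IH] [|C A] //= sub /andP[pt pts].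
apply/andP; split; last by apply: IH => // t' h; apply: sub; rewrite inE h orbT.
by apply: pattern_gsub pt _; apply: env_nodes; apply: sub; rewrite mem_head.
Qed.

Lemma expand_ranked (t : tree tag_alphabet nat) : t \in expand r ss -> ranked t.
Proof.
have := expand_typed; rewrite /typed.
elim: (expand _ _) (lhs r) => [|u us IH] [|C A] //= /andP[/andP[ru _] /IH{}IH].
by rewrite inE => /predU1P[->|].
Qed.

Lemma syms_expand :
  perm_eq (fsyms (expand r ss)) (flatten [seq syms (env x) | x <- fsyms (rhs r)]).
Proof.
rewrite /fsyms /expand -map_comp map_flatten flatten_flatten -!map_comp.
apply: perm_flatten_map => t tr /=; rewrite symsE.
apply: perm_trans (perm_map _ (nodes_gsub (env_hlinear tr))) _.
rewrite map_flatten -map_comp symsE -map_comp; apply: perm_refl_eq.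
by congr flatten; apply: eq_map => x /=; rewrite symsE.
Qed.

Lemma labelled_syms q : q \in skel_states ->
  pmap (@getN _ _) (fsyms (labelled q)) = labels q.
Proof.
move=> qS; rewrite fsymsE fnodes_refills ?size_map ?size_iota //.
rewrite unzip1_zip ?size_map ?size_iota ?size_fnodes //.
by elim: (labels q) => //= x l ->.
Qed.

(** Each nonterminal of a link occurs once in the right-hand side, and each label once in the
    skeletons of its link. This gives both the unique labelling and the link condition of the new
    rule. *)
Lemma occN_expand :
  perm_eq (occN (expand r ss)) (flatten (map labels (zip (links r) ss))).
Proof.
have [rG sz qS] := ok; rewrite occNE.
apply: perm_trans (perm_pmap _ syms_expand) _.
rewrite pmap_flatten -map_comp flatten_pmap_getN; last by move=> a /=; elim: (iota _ _).
have pN := valid_occN_perm bign_uniq (mc_rules rG).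
apply: perm_trans (perm_flatten (perm_map _ pN)) _; apply: perm_refl_eq.
have szl := all2_size (typed_flatten ok).
rewrite (map_comp (pmap _ \o @syms _ _) (nth _ _ \o index^~ _)) map_nth_index
  ?links_uniq //.
rewrite map_flatten flatten_flatten -map_comp -map_comp; congr flatten.
apply/eq_in_map => q /qS qq /=; rewrite -labelled_syms // /fsyms pmap_flatten.
by rewrite -map_comp.
Qed.

(** The states are closed under rules: however large the expansion is, its decomposition is good,
    and [good_size] applies to it. *)
Lemma skel_ok : all2 ok_skel (lhs r) (skel r ss).
Proof.
have := expand_typed; rewrite /skel /typed.
elim: (expand r ss) (lhs r) => [|t ts IH] [|C A] //= /andP[/andP[rt lt] /IH ->].
have gD := dec_good rt; rewrite andbT /ok_skel leaves_tmap.
have pl : perm_eq (leaves (dec t)) (iota 0 (rk C)).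
  by apply: perm_trans lt; rewrite -{2}(decK rt) perm_sym; apply: leaves_gsub;
    exact: good_hlinear gD.
rewrite pl /=; apply/andP; split.
  by rewrite -size_nodes nodes_tmap size_map size_nodes -[X in max_pieces _ _
    X](size_iota 0) -(perm_size pl) (good_size gD).
rewrite nodes_tmap all_map; apply/allP => -[p n] /nodesP[us <- /gD[_ le _ _]] //=.
Qed.

Lemma skel_in_states : (lhs r, skel r ss) \in skel_states.
Proof. by have [/mc_rules[[lG _ _] _] _ _] := ok;
  rewrite mem_skel_states lG skel_ok. Qed.

(** Reassembling the pieces is a linear substitution, which only permutes their symbols. The links
    of the new rule and its lexicalization depend on this. *)
Lemma syms_pieces : perm_eq (fsyms (pieces r ss)) (fsyms (expand r ss)).
Proof.
rewrite /pieces; elim: (expand r ss) expand_ranked => //= t ts IH rk_ts.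
rewrite /fsyms /= map_cat flatten_cat; apply: perm_cat; last first.
  by apply: IH => u uts; apply: rk_ts; rewrite inE uts orbT.
have rt : @ranked tag_alphabet _ t by apply: rk_ts; rewrite mem_head.
have hl := good_hlinear (dec_good rt).
rewrite -[in X in perm_eq _ X](decK rt) perm_sym symsE.
apply: perm_trans (perm_map _ (nodes_gsub hl)) _.
rewrite map_flatten -map_comp symsE -map_comp; apply: perm_refl_eq.
by congr flatten; apply: eq_map => x /=; rewrite symsE.
Qed.

Lemma fnodes_skel :
  fnodes (skel r ss) = [seq (tclassT x.1, x.2) | x <- fnodes (map dec (expand r ss))].
Proof.
rewrite /fnodes map_flatten -!map_comp; congr flatten; apply: eq_map => t /=.
exact: nodes_tmap.
Qed.

Lemma fnodes_dec : {in fnodes (map dec (expand r ss)), forall x,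
  is_piece tag_class c0 x.2 x.1}.
Proof.
move=> [p n] /flatten_mapP[D /mapP[t /expand_ranked rt ->]].
by case/nodesP=> us <- /(dec_good rt)[].
Qed.

Lemma size_pieces : size (labels (lhs r, skel r ss)) = size (pieces r ss).
Proof. by rewrite size_labels /= -size_fnodes fnodes_skel size_map size_fnodes. Qed.

Lemma zip_pieces C p : (C, p) \in zip (labels (lhs r, skel r ss)) (pieces r ss) ->
  is_piece tag_class c0 (rk C) p /\ (nt_info C).1 = tclassT p.
Proof.
have := labels_info skel_in_states; rewrite /= fnodes_skel /pieces fsymsE.
move: (labels _) fnodes_dec => ls; elim: (fnodes _) ls => [|[q n] F IH] [|x ls] //= hF.
case=> ix /IH{}IH; rewrite inE => /predU1P[[-> ->]|].
  by rewrite ix /=; split=> //; apply: (hF (q, n)); rewrite mem_head.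
by apply: IH => y yF; apply: hF; rewrite inE yF orbT.
Qed.

End Choice.

(** * Values of labels and pieces *)

Definition fill (ps : seq (tree Sigma nat)) (s : seq skeleton) : seq (tree Sigma nat) :=
  map (gsub id) (refills (Leaf 0) ps s).

(** On values, the class of a label is literally the root symbol. The foot condition concerns
    right-hand sides only and is not carried along. *)
Definition val_typed (q : skel_state) (ps : seq (tree Sigma nat)) : bool :=
  all2 (fun x p => pattern x.2 p && (troot p == Some x.1)) (fnodes q.2) ps.

Definition label_typed (C : tag_nt) (p : tree Sigma nat) : bool :=
  pattern (rk C) p && (troot p == Some (nt_info C).1).

Lemma val_typed_labels q ps : q \in skel_states ->
  val_typed q ps = all2 label_typed (labels q) ps.
Proof.
move=> qS; rewrite /val_typed -labels_info //.
by elim: (labels q) ps => [|x l IH] [|p ps] //=; rewrite IH.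
Qed.

Lemma val_typed_size q ps : val_typed q ps -> size ps = size (labels q).
Proof. by move/all2_size; rewrite size_labels size_fnodes. Qed.

Section Values.
Variables (r : rule N Sigma) (ss : seq (seq skeleton)) (pss : seq (seq (tree Sigma
  nat))).
Hypothesis ok : ok_choice r ss.
Hypothesis vt : all2 val_typed (zip (links r) ss) pss.

Let qs : seq skel_state := zip (links r) ss.
Let ls := flatten (map labels qs).

Lemma states_links : unzip1 qs = links r.
Proof. by have [_ sz _] := ok; rewrite unzip1_zip ?sz. Qed.

Lemma labels_links_uniq : uniq ls.
Proof.
have [rG _ qS] := ok; apply: uniq_flatten_map.
- apply: (@map_uniq _ _ fst); have := states_links; rewrite /unzip1 => ->.
  by have [_ []] := mc_rules rG.
- by move=> q /qS; apply: labels_uniq.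
- by move=> q q' /qS h /qS h' x; apply: labels_disjoint.
Qed.

Lemma label_typed_flatten : all2 label_typed ls (flatten pss).
Proof.
rewrite /ls /qs; have [_ _] := ok; move: vt.
elim: (zip _ _) pss => [|q qs' IH] [|p pss'] //= /andP[vp vps] qS.
have qS0 := qS q (mem_head _ _).
have := vp; rewrite val_typed_labels // => vp'.
rewrite all2_cat ?(all2_size vp') // vp' /= IH // => q' h; apply: qS;
  by rewrite inE h orbT.
Qed.

Lemma lookup_labels q ps : (q, ps) \in zip qs pss ->
  {in labels q, forall C, nth (Leaf 0) (flatten pss) (index C ls) =
     nth (Leaf 0) ps (index C (labels q))}.
Proof.
move=> qps C Cq; apply: nth_index_flatten Cq; first exact: labels_links_uniq.
  move: vt; rewrite -/qs; elim: (qs) (pss) =>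
    [|q' qs' IH] [|p pss'] //= /andP[/val_typed_size <- /IH ->] //.
elim: (qs) (pss) qps => [|q' qs' IH] [|p pss'] //=.
by rewrite !inE => /predU1P[[-> ->]|/IH ->]; rewrite ?eqxx ?orbT.
Qed.

Let env := henv (id : Sigma -> Sigma) ls (flatten pss).

Lemma label_typed_nth C : C \in ls ->
  label_typed C (nth (Leaf 0) (flatten pss) (index C ls)).
Proof.
elim: ls (flatten pss) label_typed_flatten => [|C' l IH] [|p ps] //= /andP[tp tps].
by rewrite inE eq_sym; case: eqP => [<- //|_] /=; apply: IH.
Qed.

Lemma val_env_nodes (t : tree tag_alphabet nat) :
  ranked t -> {subset pmap (@getN _ _) (syms t) <= ls} ->
  {in nodes t, forall x, pattern x.2 (env x.1) && (troot (env x.1) == Some (tag_class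
    x.1))}.
Proof.
move=> rt sub [x n] xt; have /= := rt; rewrite rankedE => /allP/(_ _ xt)/eqP /= ->.
case: x xt => [C|a] xt /=; last by rewrite eqxx andbT;
  apply: (@pattern_lift Sigma Sigma id).
apply: label_typed_nth; apply: sub; rewrite mem_pmap symsE -map_comp.
by apply/mapP; exists (inl C, n).
Qed.

(** The root of [t] is a terminal, which stays and is its own class, or a label, whose value has its
    class as root symbol. *)
Lemma troot_val_env (t : tree tag_alphabet nat) :
  ranked t -> {subset pmap (@getN _ _) (syms t) <= ls} -> isSome (troot t) ->
  troot (tsubst ls (flatten pss) t) = Some (tclassT t).
Proof.
case: t => // a ts rt sub _; rewrite tsubstE //.
have /= := val_env_nodes rt sub; move=> /(_ (a,
  size ts) (mem_head _ _)) /= /andP[_ /eqP].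
by rewrite /env; case: (henv _ _ _ _).
Qed.

Lemma expand_sub (t : tree tag_alphabet nat) : t \in expand r ss ->
  {subset pmap (@getN _ _) (syms t) <= ls}.
Proof.
move=> tu C; rewrite -(perm_mem (occN_expand ok)) occNE !mem_pmap.
case/mapP => x xt eqx; apply/mapP; exists x => //; apply/flatten_mapP; by exists t.
Qed.

Lemma pieces_sub (t : tree tag_alphabet nat) : t \in pieces r ss ->
  {subset pmap (@getN _ _) (syms t) <= ls}.
Proof.
move=> tu C; rewrite -(perm_mem (occN_expand ok)) occNE !mem_pmap.
case/mapP => x xt eqx; apply/mapP; exists x => //.
by rewrite -(perm_mem (syms_pieces ok)); apply/flatten_mapP; exists t.
Qed.

Lemma tsubst_labelled q ps : (q, ps) \in zip qs pss ->
  map (gsub env) (labelled q) = fill ps q.2.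
Proof.
move=> qps; have [_ _ qS] := ok; have qS' : q \in skel_states.
  by apply: qS; case: (in_zip qps).
have szl := size_labels q.
rewrite /fill (_ : ps = [seq env x | x <- [seq (inl x : tag_alphabet) | x <- labels
  q]]).
  rewrite -(tmap_refills (inr c0 : tag_alphabet)) ?size_map ?size_iota //.
  rewrite -map_comp; apply: eq_map => t /=; by rewrite gsub_tmap.
rewrite -map_comp; have szp : size (labels q) = size ps.
  apply/esym/val_typed_size; move: vt; rewrite -/qs; elim: (qs) (pss) qps =>
    [|q' qs' IH] [|p pss'] //=.
  by rewrite inE => /predU1P[[<- <-]|/IH h] /andP[].
rewrite -[LHS](map_nth_index (Leaf 0) (labels_uniq qS') szp).
by apply/eq_in_map => C /(lookup_labels qps) /= ->.
Qed.

(** By [gsub_gsub] the values may be put into the labelled skeletons first, which by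
    [tsubst_labelled] yields the values of the links. *)
Lemma tsubst_expand :
  map (tsubst ls (flatten pss)) (expand r ss) =
  map (tsubst (flatten (links r)) (flatten [seq fill x.2 x.1 | x <- zip ss pss]))
    (rhs r).
Proof.
have [rG sz qS] := ok.
rewrite -map_comp; apply/eq_in_map => t tr /=.
have tu : gsub (henv (inr : Sigma -> tag_alphabet) (flatten (links r))
              (flatten (map labelled qs))) t \in expand r ss by apply: map_f.
have rt' := expand_ranked ok tu.
rewrite (@tsubstE tag_nt Sigma) // (@tsubstE N Sigma) ?(rhs_ranked rG) //.
have henvt := env_nodes ok tr.
rewrite gsub_gsub; first last.
- move=> [x n] xt /= [y k] yt /=.
  have yt' : (y, k) \in nodes (gsub (henv (inr : Sigma ->
    tag_alphabet) (flatten (links r))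
              (flatten (map labelled qs))) t).
    rewrite (perm_mem (nodes_gsub (env_hlinear ok tr))); apply/flatten_mapP.
    by exists (x, n).
  by have /andP[/andP[]] := val_env_nodes rt' (expand_sub tu) yt'.
- exact: env_hlinear.
apply: eq_in_gsub => -[[C|a] n] xt; last first.
  rewrite /= -!map_comp; congr Node; apply/eq_in_map => i;
    rewrite mem_iota add0n /= => ik.
  by rewrite (nth_map 0) ?size_iota // nth_iota.
have CL : C \in flatten (links r).
  have [_ [_ _ _ ->]] := mc_rules rG.
  rewrite occNE mem_pmap; apply/mapP; exists (inl C) => //.
  apply/flatten_mapP; exists t => //; rewrite symsE; apply/mapP; exists (inl C, n) =>
    //.
have szt : size (flatten (links r)) = size (flatten (map labelled qs)).
  exact: all2_size (typed_flatten ok).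
rewrite -(nth_map (Leaf 0) (Leaf 0) (gsub env)) -?szt ?index_mem //; congr nth.
rewrite map_flatten -map_comp; congr flatten.
have key Bs ss' pss' : size ss' = size Bs -> size (zip Bs ss') = size pss' ->
    {subset zip (zip Bs ss') pss' <= zip qs pss} ->
    [seq map (gsub env) (labelled q) | q <- zip Bs ss'] =
    [seq fill x.2 x.1 | x <- zip ss' pss'].
  elim: Bs ss' pss' => [|B Bs IH] [|s ss'] [|p pss'] //= [sz'] [szp] sub.
  rewrite (@tsubst_labelled (B, s) p); last by apply: sub; rewrite mem_head.
  by rewrite (IH _ pss') // => x xz; apply: sub; rewrite inE xz orbT.
by apply: key => //; apply: all2_size vt.
Qed.

(** Since [gsub id] undoes [dec] and [gsub] composes, substitution acts on each piece separately and
    leaves the skeleton alone. *)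
Lemma fill_pieces :
  fill (map (tsubst ls (flatten pss)) (pieces r ss)) (skel r ss) =
  map (tsubst ls (flatten pss)) (expand r ss).
Proof.
rewrite /fill /skel /pieces.
rewrite -(tmap_refills (Leaf 0)); last first.
  by rewrite -[RHS]size_fnodes -/(skel r ss) fnodes_skel size_map size_fnodes.
rewrite refills_fsyms; move: pieces_sub (expand_ranked ok); rewrite /pieces.
move: (expand r ss) => us psub rus; rewrite -!map_comp.
apply/eq_in_map => t' tu /=; rewrite gsub_tmap.
have rt' := rus _ tu; have gD := dec_good rt'.
rewrite (@tsubstE tag_nt Sigma) //.
have hD := good_hlinear gD.
have henvp p n : (p, n) \in nodes (dec t') ->
    ranked p /\ {in nodes p, forall x,
      pattern x.2 (env x.1) && (troot (env x.1) == Some (tag_class x.1))}.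
  move=> pn; have pD : p \in fsyms (map dec us).
    apply/flatten_mapP; exists (dec t'); first exact: map_f.
    by rewrite symsE; apply/mapP; exists (p, n).
  have rp : ranked p by case/nodesP: pn => ts _ /gD[[/andP[]]].
  by split=> //; apply: val_env_nodes => //; apply: psub.
rewrite -[in RHS](decK rt') gsub_gsub //.
  by apply: eq_in_gsub => -[p n] /henvp[rp _]; rewrite (@tsubstE tag_nt Sigma).
by move=> [p n] /henvp[_ hp] x /hp /andP[/andP[]].
Qed.

Lemma val_typed_pieces :
  val_typed (lhs r, skel r ss) (map (tsubst ls (flatten pss)) (pieces r ss)).
Proof.
rewrite val_typed_labels; last exact: skel_in_states.
have := zip_pieces ok; have := size_pieces r ss;
  have : {subset pieces r ss <= pieces r ss} by [].
elim: {1 3 4 5}(pieces r ss) (labels _) => [|p ps IH] [|C l] //= sub [sz] zp.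
apply/andP; split; last first.
  apply: IH => // [q h|C' q h]; first by apply: sub; rewrite inE h orbT.
  by apply: zp; rewrite inE h orbT.
have pp : p \in pieces r ss by apply: sub; rewrite mem_head.
have [[pat nod _] cl] := zp C p (mem_head _ _).
have /andP[rp _] := pat.
rewrite /label_typed troot_val_env //; last exact: pieces_sub.
rewrite cl eqxx andbT (@tsubstE tag_nt Sigma) //; apply: pattern_gsub pat _.
by move=> x /(val_env_nodes rp (pieces_sub pp)) /andP[].
Qed.

End Values.

(** * Skeletons and pieces of a derivation *)

Notation dval := (@Defs.tval Sigma G).

Fixpoint der_skel (d : tree (ruleA G) void) : seq skeleton :=
  match d with
  | Leaf v => match v with end
  | Node r ds => skel (ssval r) (map der_skel ds)
  end.

(** These are the values that the labels of the state of [d] have to receive. They are computed from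
    [d] without the new grammar; [tag_rule_val] matches them with its derivations. *)
Fixpoint der_pieces (d : tree (ruleA G) void) : seq (tree Sigma nat) :=
  match d with
  | Leaf v => match v with end
  | Node r ds =>
      map (tsubst (flatten (map labels (zip (links (ssval r)) (map der_skel ds))))
             (flatten (map der_pieces ds)))
          (pieces (ssval r) (map der_skel ds))
  end.

Definition der_state (A : seq N) (d : tree (ruleA G) void) : skel_state :=
  (A, der_skel d).

Definition der_ok (A : seq N) (d : tree (ruleA G) void) : Prop :=
  [/\ der_state A d \in skel_states, val_typed (der_state A d) (der_pieces d)
    & fill (der_pieces d) (der_skel d) = dval d].

Lemma children_ok (r : ruleA G) (ds : seq (tree (ruleA G) void)) :
  size ds = rk r ->
  (forall B d, (B, d) \in zip (links (ssval r)) ds -> der_ok B d) ->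
  [/\ ok_choice (ssval r) (map der_skel ds),
      all2 val_typed (zip (links (ssval r)) (map der_skel ds)) (map der_pieces ds)
    & [seq fill x.2 x.1 | x <- zip (map der_skel ds) (map der_pieces ds)] = map dval
      ds].
Proof.
move=> sz okd.
have [qS vt fl] : [/\ {in zip (links (ssval r)) (map der_skel ds), forall q,
  q \in skel_states},
   all2 val_typed (zip (links (ssval r)) (map der_skel ds)) (map der_pieces ds)
   & [seq fill x.2 x.1 | x <- zip (map der_skel ds) (map der_pieces ds)] = map dval ds].
  move: sz okd; rewrite /=; elim: (links (ssval r)) ds =>
    [|B Bs IH] [|d ds] //= [sz] okd.
  have [|qS vt fl] := IH _ sz; first by move=> B' d' h; apply: okd; rewrite inE h orbT.
  have [qS0 vt0 fl0] := okd B d (mem_head _ _).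
  split; rewrite ?fl ?fl0 ?vt0 //.
  by move=> q; rewrite inE => /predU1P[->|/qS].
by split=> //; split; rewrite ?ssvalP // size_map.
Qed.

Lemma der_inv A d : der A d -> der_ok A d.
Proof.
elim=> r ds sz _ IH; have [ok vt fl] := children_ok sz IH.
split; [exact: skel_in_states | exact: val_typed_pieces |].
by rewrite /= fill_pieces // tsubst_expand // fl.
Qed.

(* Only productive states are used: the roots of initial rules must be roots of
   trees of L(G) for root consistency to apply. *)
Definition productive (q : skel_state) : Prop :=
  exists2 d, der q.1 d & der_skel d = q.2.

Definition good_choice (r : rule N Sigma) (ss : seq (seq skeleton)) : Prop :=
  ok_choice r ss /\ {in zip (links r) ss, forall q, productive q}.

Definition is_init (r : rule N Sigma) : bool := lhs r == [:: init G].

(** A rule that is not initial and has no pieces would get the empty sequence as left-hand side; the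
    last condition removes it. *)
Definition choices : seq (rule N Sigma * seq (seq skeleton)) :=
  [seq x <- [seq (r, ss) | r <- rules G,
    ss <- seqs (unzip2 skel_states) (size (links r))]
  | `[< good_choice x.1 x.2 >] && (is_init x.1 || (pieces x.1 x.2 != [::]))].

Lemma mem_choices r ss :
  (r, ss) \in choices <-> good_choice r ss /\ (is_init r || (pieces r ss != [::])).
Proof.
rewrite mem_filter /=; split; first by case/andP=> /andP[/asboolP].
case=> gc ->; rewrite asboolT //=; case: gc => [[rG sz qS] _].
apply/allpairsPdep; exists r, ss; split=> //; rewrite -sz; apply: mem_seqs => s sss.
have sz' : size (links r) = size ss by [].
have: s \in unzip2 (zip (links r) ss) by rewrite unzip2_zip ?sz.
by case/mapP => q /qS qS' ->; apply: map_f.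
Qed.

Definition tag_bign : seq (seq tag_nt) :=
  [:: None] :: undup [seq labels q | q <- skel_states & `[< productive q >] &&
    (labels q != [::])].

(* Filtering the fixed enumeration of big nonterminals makes the order of the
   links depend on the set of links only, and drops the links with no label. *)
Definition tag_links (r : rule N Sigma) (ss : seq (seq skeleton)) : seq (seq tag_nt) :=
  [seq B <- tag_bign | B \in map labels (zip (links r) ss)].

(* The trees of initial rules are not cut: the unique initial nonterminal cannot
   record the class of a root. *)
Definition tag_rule (x : rule N Sigma * seq (seq skeleton)) : rule tag_nt Sigma :=
  if is_init x.1 then Rule [:: None] (expand x.1 x.2) (tag_links x.1 x.2)
  else Rule (labels (lhs x.1, skel x.1 x.2)) (pieces x.1 x.2) (tag_links x.1 x.2).

Lemma links_tag_rule x : links (tag_rule x) = tag_links x.1 x.2.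
Proof. by rewrite /tag_rule; case: ifP. Qed.

Lemma tag_bignP B :
  reflect (B = [:: None] \/ exists q, [/\ q \in skel_states, productive q,
    labels q != [::]
    & B = labels q]) (B \in tag_bign).
Proof.
rewrite inE mem_undup; apply: (iffP idP).
  case/predU1P=> [->|/mapP[q]]; first by left.
  by rewrite mem_filter => /andP[/andP[/asboolP pq nq] qS] ->; right; exists q.
case=> [->|[q [qS pq nq ->]]]; first by rewrite eqxx.
by apply/orP; right; apply: map_f; rewrite mem_filter asboolT //= nq.
Qed.

Lemma tag_bign_uniq : uniq tag_bign.
Proof.
rewrite /= undup_uniq andbT mem_undup; apply/mapP => -[q].
rewrite mem_filter => /andP[_ qS] e; have := labels_None qS; by rewrite -e mem_head.
Qed.

Lemma tag_bign_disjoint : {in tag_bign &, forall B B' x, x \in B -> x \in B' -> B = B'}.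
Proof.
move=> B B' /tag_bignP[->|[q [qS _ _ ->]]] /tag_bignP[->|[q' [q'S _ _ ->]]] x //.
- rewrite inE => /eqP ->; by rewrite (negPf (labels_None q'S)).
- move=> xq; rewrite inE => /eqP xN; by move: xq; rewrite xN (negPf (labels_None qS)).
- by move=> h h'; rewrite (labels_disjoint qS q'S h h').
Qed.

Lemma tag_bign_nonempty : {in tag_bign, forall B, B != [::] /\ uniq B}.
Proof.
by move=> B /tag_bignP[->|[q [qS _ nq ->]]] //; split=> //; apply: labels_uniq.
Qed.

Lemma tag_bign_occ : {in tag_bign &, forall B B' : seq tag_nt, B =i B' -> B = B'}.
Proof.
move=> B B' hB hB' e; have [nB _] := tag_bign_nonempty hB.
case: B nB hB e => // x B _ hB e.
by apply: (tag_bign_disjoint hB hB' (mem_head x B)); rewrite -e mem_head.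
Qed.

Section GoodChoice.
Variables (r : rule N Sigma) (ss : seq (seq skeleton)).
Hypothesis gc : good_choice r ss.

Let ok : ok_choice r ss := proj1 gc.

Lemma mem_tag_links B : B \in tag_links r ss <->
  exists2 q, q \in zip (links r) ss & B = labels q /\ B != [::].
Proof.
have [_ _ qS] := ok; rewrite mem_filter; split.
  case/andP=> /mapP[q qz ->] h; exists q => //; split=> //.
  by have [] := tag_bign_nonempty h.
case=> q qz [-> nq]; rewrite map_f //=; apply/tag_bignP; right; exists q.
by split=> //; [apply: qS | apply: (proj2 gc)].
Qed.

Lemma tag_links_perm :
  perm_eq (flatten (tag_links r ss)) (flatten (map labels (zip (links r) ss))).
Proof.
apply: uniq_perm.
- rewrite -[tag_links _ _]map_id; apply: uniq_flatten_map.
  + by rewrite filter_uniq // tag_bign_uniq.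
  + by move=> B; rewrite mem_filter => /andP[_ /tag_bign_nonempty[]].
  + move=> B B'; rewrite !mem_filter => /andP[_ h] /andP[_ h'];
    exact: tag_bign_disjoint.
- have [_ _ qS] := ok; apply: uniq_flatten_map; last first.
  + by move=> q q' /qS h /qS h' x; apply: labels_disjoint.
  + by move=> q /qS; apply: labels_uniq.
  apply: (@map_uniq _ _ fst); have := states_links ok; rewrite /unzip1 => ->.
  by have [rG _ _] := ok; have [_ []] := mc_rules rG.
move=> x; apply/flattenP/flatten_mapP => [[B /mem_tag_links[q qz [-> _]] xq]|[q qz xq]].
  by exists q.
exists (labels q) => //; apply/mem_tag_links; exists q => //; split=> //.
by case: (labels q) xq.
Qed.

(** Productivity supplies a derivation for each link. These derivations witness trees of L(G) in
    [init_root] and provide the constants of the transducer back to [G]. *)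
Lemma choice_derivation : exists ds,
  [/\ map der_skel ds = ss, size ds = size (links r)
    & forall B d, (B, d) \in zip (links r) ds -> der B d].
Proof.
case: gc => -[_ + _]; elim: (links r) (ss) => [|B Bs IH] [|s ss'] //= => [_ _|[sz] pr].
  by exists [::].
have [|ds [dss szd dd]] := IH _ sz; first by move=> q h; apply: pr; rewrite inE h orbT.
have [d dB ds0] := pr (B, s) (mem_head _ _).
exists (d :: ds); split; rewrite /= ?ds0 ?dss ?szd // => B' d'.
by rewrite inE => /predU1P[[-> ->]|/dd].
Qed.

Lemma productive_lhs : productive (lhs r, skel r ss).
Proof.
have [ds [dss szd dd]] := choice_derivation; have [rG _ _] := ok.
exists (Node (SeqSub rG : ruleA G) ds); last by rewrite /= dss.
by apply: (@Der _ _ (SeqSub rG : ruleA G)).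
Qed.

Lemma init_expand : is_init r -> exists2 t,
  expand r ss = [:: t] & @pattern tag_alphabet 0 t.
Proof.
move/eqP=> e; have := expand_typed ok; rewrite e /typed.
case: (expand _ _) => [|t []] //=; last by move=> ? ?; rewrite andbF.
by rewrite mc_init_rk andbT => pt; exists t.
Qed.

Lemma occN_tag_rule :
  perm_eq (occN (rhs (tag_rule (r, ss)))) (flatten (map labels (zip (links r) ss))).
Proof.
apply: perm_trans (occN_expand ok); rewrite /tag_rule /=; case: ifP => _ //=.
rewrite !occNE; exact/perm_pmap/syms_pieces.
Qed.

Lemma tag_rule_valid : is_init r || (pieces r ss != [::]) ->
  valid_rule tag_bign (tag_rule (r, ss)).
Proof.
move=> kept; have lk := links_tag_rule (r, ss).
split; split.
- rewrite /tag_rule /=; case: ifP kept => [_ _|ni /= ne]; first exact: mem_head.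
  apply/tag_bignP; right; exists (lhs r, skel r ss).
  split; rewrite ?skel_in_states //; first exact: productive_lhs.
  by rewrite -size_eq0 size_pieces size_eq0.
- rewrite /tag_rule /=; case: ifP => [ini|_] /=.
    by have [t -> pt] := init_expand ini; rewrite /= pt.
  have := zip_pieces ok; have := size_pieces r ss.
  elim: (labels _) (pieces _ _) => [|C l IH] [|p ps] //= [sz] zp.
  apply/andP; split; first by have [[]] := zp C p (mem_head _ _).
  by apply: IH => // C' p' h; apply: zp; rewrite inE h orbT.
- by rewrite (perm_uniq occN_tag_rule) -(perm_uniq tag_links_perm) -[tag_links _
  _]map_id;
    apply: uniq_flatten_map; rewrite ?filter_uniq ?tag_bign_uniq //;
    [move=> B; rewrite mem_filter => /andP[_ /tag_bign_nonempty[]]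
    |move=> B B'; rewrite !mem_filter => /andP[_ h] /andP[_ h'];
      exact: tag_bign_disjoint].
- by rewrite lk filter_uniq // tag_bign_uniq.
- by rewrite lk => B; rewrite mem_filter => /andP[].
- rewrite lk => B B'; rewrite !mem_filter => /andP[_ h] /andP[_ h'] ne.
  rewrite disjoint_subset; apply/subsetP => x xB; rewrite inE; apply/negP => xB'.
  by move: ne; rewrite (tag_bign_disjoint h h' xB xB') eqxx.
- by move=> x; rewrite lk (perm_mem tag_links_perm) (perm_mem occN_tag_rule).
Qed.

Lemma tag_rule_start : None \notin occN (rhs (tag_rule (r, ss))).
Proof.
rewrite (perm_mem occN_tag_rule); apply/negP => /flatten_mapP[q].
by have [_ _ qS] := ok => /qS/labels_None/negPf ->.
Qed.

End GoodChoice.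

Definition tag_rules : seq (rule tag_nt Sigma) := map tag_rule choices.

Lemma tag_rules_valid : {in tag_rules, forall r, valid_rule tag_bign r}.
Proof. by move=> _ /mapP[[r ss] /mem_choices[gc kept] ->]; apply: tag_rule_valid. Qed.

Lemma tag_rules_start : {in tag_rules, forall r, None \notin occN (rhs r)}.
Proof. by move=> _ /mapP[[r ss] /mem_choices[gc kept] ->]; apply: tag_rule_start. Qed.

Lemma tag_link_order : {in tag_rules &, forall r r' : rule tag_nt Sigma,
    lhs r = lhs r' -> rhs r = rhs r' -> links r =i links r' -> r = r'}.
Proof.
move=> _ _ /mapP[[r ss] _ ->] /mapP[[r' ss'] _ ->].
move=> el er; rewrite !links_tag_rule => eq.
have {eq}: tag_links r ss = tag_links r' ss'.
  by apply: eq_in_filter => B hB; move: (eq B); rewrite !mem_filter hB !andbT.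
move: (links_tag_rule (r, ss)) (links_tag_rule (r', ss')) el er => /=.
by case: (tag_rule _) => l1 h1 k1; case: (tag_rule _) => l2 h2 k2 /= -> -> -> -> ->.
Qed.

Definition tagG : mcftg Sigma :=
  @Mcftg Sigma tag_nt tag_bign None tag_rules (mc_mr G) tag_bign_nonempty tag_bign_occ
    (mem_head _ _) erefl tag_rules_valid tag_link_order tag_rules_start.

(** * Multiplicity and lexicalization *)

Lemma size_fsyms_skel (A : seq N) (s : seq skeleton) K :
  all2 ok_skel A s -> (forall C, max_pieces Sigma m (@rk N C) <= K) ->
  size (fsyms s) <= size A * K.
Proof.
move=> + hK; elim: A s => [|C A IH] [|t s] //= /andP[/and3P[_ le _] /IH{}IH].
rewrite /fsyms /= size_cat mulSn leq_add //; exact: leq_trans le (hK C).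
Qed.

Lemma multiplicity_tagG :
  multiplicity tagG <=
    (if width G == 0 then multiplicity G
     else multiplicity G * #|Sigma| * m ^ 2 * (2 * width G - 1)).
Proof.
have card_gt0 : 0 < #|Sigma| by apply/card_gt0P; exists c0.
have m_gt0 : 0 < m := mc_mr G.
have mult_gt0 : 0 < multiplicity G.
  rewrite /multiplicity; apply: leq_trans (_ : size [:: init G] <= _) => //.
  exact: (@leq_bigmax_seq _ _ _ _ [:: init G] (mc_init G)).
(* In width 0 all components are closed, and a closed tree is one piece. *)
set K := (if width G == 0 then 1 else #|Sigma| * m ^ 2 * (2 * width G - 1)).
have K_gt0 : 0 < K.
  by rewrite /K; case: eqP => // /eqP; rewrite -lt0n => w;
    rewrite !muln_gt0 card_gt0 ?expn_gt0 ?m_gt0 /=; lia.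
have -> : (if width G == 0 then multiplicity G
     else multiplicity G * #|Sigma| * m ^ 2 * (2 * width G - 1)) = multiplicity G * K.
  by rewrite /K; case: ifP => _; rewrite ?muln1 // !mulnA.
have hK (C : N) : max_pieces Sigma m (rk C) <= K.
  have le : rk C <= width G := rk_mr C; rewrite /max_pieces.
  case rkC : (rk C) le => [//|k] le; rewrite /K ifN; last
    by rewrite -lt0n (leq_trans _ le).
  apply: leq_mul; last by lia.
  (* [max_pieces] has a single factor [m], which is weakened to [m ^ 2] here. *)
  by rewrite mulnC leq_mul // -{1}[m]expn1 leq_pexp2l.
apply/bigmax_leqP_seq => B /tag_bignP hB _.
case: hB => [->|[q [qS _ _ ->]]].
  by rewrite /= muln_gt0 mult_gt0.
rewrite size_labels; move: qS; rewrite mem_skel_states => /andP[qG ok].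
apply: leq_trans (size_fsyms_skel ok hK) _; rewrite leq_mul2r; apply/orP; right.
exact: (@leq_bigmax_seq _ _ _ _ q.1 qG).
Qed.

(** An initial rule without links yields an initial rule without links, so a proper new rule comes
    from a proper rule. The new rule may have lost links, but it keeps every terminal of the old
    right-hand side. *)
Lemma lexicalized_tagG (Delta : {set Sigma}) :
  lexicalized G Delta -> lexicalized tagG Delta.
Proof.
move=> lex _ /mapP[[r ss] /mem_choices[[ok _] _] ->].
have [rG sz _] := ok.
have in_expand a : a \in occT (rhs r) -> a \in occT (expand r ss).
  rewrite !mem_occT (perm_mem (syms_expand ok)) => h.
  by apply/flatten_mapP; exists (inr a); rewrite //= mem_head.
rewrite /proper_rule => prop.
have pr : proper_rule r.
  apply: contra prop => /andP[ini ter]; apply/andP; split.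
    by rewrite /initial_rule /tag_rule /= -/(is_init r) /is_init -/(initial_rule r) ini.
  rewrite /terminal_rule links_tag_rule /tag_links /= (eqP ter).
  have -> : zip [::] ss = [::] :> seq skel_state by case: (ss).
  by rewrite (eq_filter (a2 := pred0)) ?filter_pred0.
have /hasP[a ar aD] := lex r rG pr; apply/hasP; exists a => //.
have := in_expand a ar; rewrite /tag_rule; case: ifP => //= _.
by rewrite !mem_occT (perm_mem (syms_pieces ok)).
Qed.

Lemma der_tree_lang A d : der A d -> lang A (dval d).
Proof.
elim=> r ds sz _ IH /=.
have rG : ssval r \in rules G := ssvalP r.
have [_ [ul _ _ _]] := mc_rules rG.
(* The links are distinct, so the values can be given as a function of the link, through its
   index. *)
have -> : map dval ds = [seq nth [::] (map dval ds) (index B (links (ssval r))) | B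
  <- links (ssval r)].
  by rewrite map_nth_index // size_map.
apply: Lang => // B Br.
have ilt : index B (links (ssval r)) < size ds by rewrite sz index_mem.
rewrite (nth_map (Node r ds)) //; apply: IH.
rewrite -{1}(nth_index [::] Br) -nth_zip //; apply: mem_nth;
  by rewrite size_zip sz minnn index_mem.
Qed.

(** The choice is productive, so actual values can be substituted for the labels; the root of the
    resulting tree is the class of the root of [t], even if that root is a label. *)
Lemma init_root r ss t : good_choice r ss -> is_init r -> expand r ss = [:: t] ->
  exists2 t', tree_lang G t' & troot t' = Some (tclassT t).
Proof.
move=> gc ini et; have [ds [dss szd dd]] := choice_derivation gc.
have ok := proj1 gc; have [rG _ _] := ok.
have dr : @der Sigma G (lhs r) (Node (SeqSub rG : ruleA G) ds)
  by apply: (@Der _ _ (SeqSub rG : ruleA G)).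
have [|_ vt fl] := @children_ok (SeqSub rG : ruleA G) ds szd.
  by move=> B d /dd; apply: der_inv.
have := der_tree_lang dr; rewrite (eqP ini) /= -fl.
rewrite /= dss in vt *; rewrite -tsubst_expand // et /=.
set t' := tsubst _ _ _ => lt; exists t' => //.
have [t1 [e1] pt] := init_expand gc ini; move: e1; rewrite et => -[e1].
have tu : t \in expand r ss by rewrite et mem_head.
apply: troot_val_env => //; first exact: (expand_ranked ok tu);
  first exact: (expand_sub ok tu).
by rewrite e1; case: (t1) pt => // i /andP[_ /perm_size].
Qed.

Definition is_root (a : Sigma) : Prop := exists2 t, tree_lang G t & troot t = Some a.

(* The classes of the root symbols of L(G) are merged into the class c0, which is
   that of the initial nonterminal; root consistency is condition (1). *)
Lemma mc_tag_tagG : root_consistent (@tree_lang Sigma G) ->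
  ((exists a, is_root a) -> is_root c0) -> mc_tag tagG.
Proof.
move=> rc hc0; split.
  move=> _ /mapP[[r ss] /mem_choices[gc kept] ->] C t; rewrite /tag_rule /=.
  case: ifP => [ini|_] /=.
    case: (expand r ss) => [|u us] //=; rewrite inE => h.
    left; case/orP: h => [/eqP[-> _]//|]; by case: us.
  case/(zip_pieces (proj1 gc)) => -[_ _ foot] _.
  have [|h] := posnP (@rk (nt tagG) C); [by left|right; split=> //].
  by have [b fb _] := foot h; exists b.
pose f a := if `[< is_root a >] then c0 else a.
have fc0 : f c0 = c0 by rewrite /f; case: ifP.
exists (fun x y => f (tag_class x) == f (tag_class y)).
  by split=> [x|x y|y x z /eqP -> //]; rewrite // eq_sym.
split.
- move=> a b ab; rewrite /= /f; case: asboolP => [ra|na]; case: asboolP => [rb|nb].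
  + by move=> _; case: ra rb => t lt ta [t' lt' tb]; apply: rc lt lt' ta tb ab.
  + by move/eqP=> e; case: nb; rewrite -e; apply: hc0; exists a.
  + by move/eqP=> e; case: na; rewrite e; apply: hc0; exists b.
  + by move/eqP=> e; rewrite e eqxx in ab.
- by move=> C; exists (nt_info C).1.
move=> _ /mapP[[r ss] /mem_choices[gc kept] ->] C t; rewrite /tag_rule /=.
case: ifP => [ini|_] /=.
  have [u eu pu] := init_expand gc ini; rewrite eu /= inE => /eqP[-> ->]; split=> //.
  case: u eu pu => [i|a us] eu pu; first by case/andP: pu => _ /perm_size.
  exists a => //; rewrite /= fc0 /f asboolT //.
  by have [t' lt' rt'] := init_root gc ini eu; exists t'.
case/(zip_pieces (proj1 gc)) => -[_ nod foot] cl; split.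
  by case: t nod cl {foot} => // a ts _ cl; exists a => //; rewrite /= cl.
by move=> /foot[b fb cb]; exists b => //; rewrite /= cl cb.
Qed.

Lemma children_good (r : ruleA G) (ds : seq (tree (ruleA G) void)) :
  size ds = rk r ->
  (forall B d, (B, d) \in zip (links (ssval r)) ds -> der B d) ->
  good_choice (ssval r) (map der_skel ds).
Proof.
move=> sz dd; have [ok _ _] := children_ok sz (fun B d h => der_inv (dd B d h)).
split=> // q; move: sz dd {ok} => /=.
elim: (links (ssval r)) ds => [|B Bs IH] [|d ds] //= [sz] dd.
rewrite inE => /predU1P[->|h]; first by exists d => //; apply: dd; rewrite mem_head.
by apply: IH h => // B' d' h; apply: dd; rewrite inE h orbT.
Qed.

(** [tsubst] depends only on the value found for each label that occurs. Neither the new order of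
    the links nor the loss of those without labels changes it. *)
Lemma tag_subst r ss pss us (t : tree tag_alphabet nat) :
  good_choice r ss -> all2 val_typed (zip (links r) ss) pss ->
  size us = size (tag_links r ss) ->
  (forall q ps, (q, ps) \in zip (zip (links r) ss) pss -> labels q != [::] ->
     nth [::] us (index (labels q) (tag_links r ss)) = ps) ->
  ranked t -> {subset pmap (@getN _ _) (syms t) <= flatten (map labels (zip (links r)
    ss))} ->
  tsubst (flatten (tag_links r ss)) (flatten us) t =
  tsubst (flatten (map labels (zip (links r) ss))) (flatten pss) t.
Proof.
move=> gc vt szu hus rt sub; have ok := proj1 gc.
apply: (@eq_tsubst tag_nt Sigma) => // C /sub/flatten_mapP[q qz Cq].
have zipped q' : q' \in zip (links r) ss -> exists2 ps, (q',
  ps) \in zip (zip (links r) ss) pss & val_typed q' ps.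
  elim: (zip (links r) ss) (pss) vt => [|q0 qs IH] [|p0 ps0] //= /andP[v0 vs].
  rewrite inE => /predU1P[->|/(IH _ vs)[ps h v]].
    by exists p0; rewrite ?mem_head.
  by exists ps; rewrite // inE h orbT.
have [ps qps vps] := zipped q qz.
rewrite (lookup_labels ok vt qps) //.
have nq : labels q != [::] by case: (labels q) Cq.
have ql : labels q \in tag_links r ss by apply/(mem_tag_links gc); exists q.
have nthq := hus q ps qps nq.
have shapes : map size (tag_links r ss) = map size us.
  apply: (@eq_from_nth _ 0); rewrite ?size_map // => j jlt.
  rewrite !(nth_map [::]) ?szu //.
  have := mem_nth [::] jlt => /(mem_tag_links gc)[q' q'z [eq nq']].
  have [ps' q'ps' vps'] := zipped q' q'z.
  rewrite eq in nq'; have := hus q' ps' q'ps' nq'; rewrite -eq index_uniq //;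
    last first.
    by rewrite filter_uniq // tag_bign_uniq.
  by move=> ->; rewrite eq (val_typed_size vps').
apply: nth_index_flatten Cq => //.
  by rewrite (perm_uniq (tag_links_perm gc)); apply: labels_links_uniq ok.
rewrite -[labels q in X in X \in _](nth_index [::] ql) -nthq -nth_zip //.
by apply: mem_nth; rewrite size_zip szu minnn index_mem.
Qed.

(** The step common to both transducers: once the remaining links have the right values, so has the
    new rule. An initial rule is not cut and thus yields the whole value. *)
Lemma tag_rule_val (r : ruleA G) (ds : seq (tree (ruleA G) void)) us :
  size ds = rk r ->
  (forall B d, (B, d) \in zip (links (ssval r)) ds -> der B d) ->
  size us = size (tag_links (ssval r) (map der_skel ds)) ->
  (forall B d, (B, d) \in zip (links (ssval r)) ds -> labels (der_state B d) != [::] ->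
     nth [::] us (index (labels (der_state B d)) (tag_links (ssval r) (map der_skel
       ds)))
       = der_pieces d) ->
  map (tsubst (flatten (tag_links (ssval r) (map der_skel ds))) (flatten us))
      (rhs (tag_rule (ssval r, map der_skel ds))) =
  if is_init (ssval r) then dval (Node r ds) else der_pieces (Node r ds).
Proof.
move=> sz dd szu hus.
have [ok vt fl] := children_ok sz (fun B d h => der_inv (dd B d h)).
have gc := children_good sz dd.
have hus' q ps : (q, ps) \in zip (zip (links (ssval r)) (map der_skel ds)) (map
  der_pieces ds) ->
   labels q != [::] ->
   nth [::] us (index (labels q) (tag_links (ssval r) (map der_skel ds))) = ps.
  move=> h; suff [B [d [Bd -> ->]]] : exists B d, [/\ (B,
    d) \in zip (links (ssval r)) ds,
     q = der_state B d & ps = der_pieces d] by apply: hus.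
  elim: (links (ssval r)) (ds) h => [|B Bs IH] [|d ds'] //=.
  rewrite inE => /predU1P[[-> ->]|/IH[B' [d' [h e1 e2]]]].
    by exists B, d; rewrite mem_head.
  by exists B', d'; rewrite inE h orbT.
have sub t := @tag_subst _ _ _ _ t gc vt szu hus'.
rewrite /tag_rule /=; case: ifP => _ /=.
  rewrite -fl -tsubst_expand //; apply/eq_in_map => t tu.
  by apply: sub; [exact: (expand_ranked ok tu) | exact: (expand_sub ok tu)].
apply/eq_in_map => t tp; apply: sub; last exact: (pieces_sub ok tp).
have: exists C, (C, t) \in zip (labels (lhs (ssval r),
  skel (ssval r) (map der_skel ds)))
    (pieces (ssval r) (map der_skel ds)).
  have := size_pieces (ssval r) (map der_skel ds).
  elim: (pieces _ _) (labels _) tp => //= p ps IH [|C l] //=; rewrite inE =>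
    /predU1P[->|h] [sz'].
    by exists C; rewrite mem_head.
  by have [C' h'] := IH _ h sz'; exists C'; rewrite inE h' orbT.
by case=> C /(zip_pieces ok)[[/andP[]]].
Qed.

Lemma der_ranked A d : der A d -> @ranked (ruleA G) void d.
Proof.
elim=> r ds sz _ IH; rewrite /= sz eqxx /=.
move: sz IH => /=; elim: (links (ssval r)) ds => [|B Bs IHB] [|d0 ds0] //= [sz] IH.
rewrite (IH B d0) ?mem_head // IHB // => B' d' h; apply: (IH B').
by rewrite inE h orbT.
Qed.

(** * The transducers *)

(* [None] is the sink state, reached on trees that are not derivations. *)
Definition la_state : finType := option (seq_sub skel_states).

(** On a ranked tree, a child in the sink state makes [l] shorter than the list of links, so the
    test fails and the sink propagates. The same test checks that the children derive from the
    links. *)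
Definition la_delta (r : ruleA G) (qs : seq la_state) : la_state :=
  let l : seq skel_state := pmap (fun q : la_state => omap (@ssval _ _) q) qs in
  if unzip1 l == links (ssval r)
  then insub ((lhs (ssval r), skel (ssval r) (unzip2 l)) : skel_state) else None.

Lemma run_der A d : der A d -> run la_delta d = insub (der_state A d).
Proof.
elim=> r ds sz dd IH; have [ok _ _] := children_ok sz (fun B d h => der_inv (dd B d h)).
rewrite /= /la_delta.
have -> : pmap (fun q : la_state => omap (@ssval _ _) q) (map (run la_delta) ds) =
    zip (links (ssval r)) (map der_skel ds).
  have [_ _ qS] := ok; move: sz IH qS {ok dd} => /=.
  elim: (links (ssval r)) ds => [|B Bs IHB] [|d0 ds0] //= [sz] IH qS.
  rewrite (IH B d0) ?mem_head // insubT ?qS ?mem_head //= => h; rewrite IHB //.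
    by move=> B' d' h'; apply: IH; rewrite inE h' orbT.
  by move=> q h'; apply: qS; rewrite inE h' orbT.
by rewrite unzip1_zip ?unzip2_zip ?size_map ?sz ?eqxx.
Qed.

(** Each choice becomes one transducer rule: its symbol is the rule of [G], and the look-ahead at
    the children selects the skeletons. A single transducer state therefore suffices. *)
Definition fwd_trule : finType := seq_sub choices.

Definition ch_rule (x : fwd_trule) := (ssval x).1.
Definition ch_skels (x : fwd_trule) := (ssval x).2.
Definition ch_states (x : fwd_trule) : seq skel_state :=
  zip (links (ch_rule x)) (ch_skels x).

Lemma ch_good x : good_choice (ch_rule x) (ch_skels x).
Proof.
by have := ssvalP x; rewrite (surjective_pairing (ssval x)) => /mem_choices[].
Qed.

Lemma ch_in_rules x : ch_rule x \in rules G.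
Proof. by have [[]] := ch_good x. Qed.

Lemma size_ch_states x : size (ch_states x) = size (links (ch_rule x)).
Proof. by have [[_ sz _] _] := ch_good x; rewrite size_zip sz minnn. Qed.

Definition fwd_sym (x : fwd_trule) : ruleA G := SeqSub (ch_in_rules x).

Definition fwd_la (x : fwd_trule) (i : nat) (t : tree (ruleA G) void) : Prop :=
  ranked t /\ run la_delta t = insub (nth (([::], [::]) : skel_state) (ch_states x) i).

Lemma fwd_in_rules (x : fwd_trule) : tag_rule (ssval x) \in rules tagG.
Proof. exact: map_f (ssvalP x). Qed.

Definition fwd_rule (x : fwd_trule) : ruleA tagG := SeqSub (fwd_in_rules x).

Definition fwd_pos (x : fwd_trule) (B : seq tag_nt) : nat :=
  index B (map labels (ch_states x)).

Definition ch_links (x : fwd_trule) : seq (seq tag_nt) :=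
  tag_links (ch_rule x) (ch_skels x).

Definition fwd_rhs (x : fwd_trule) : tree (ruleA tagG) (unit * nat) :=
  Node (fwd_rule x) [seq Leaf (tt, fwd_pos x B) | B <- ch_links x].

Lemma fwd_la_regular x i : i < rk (fwd_sym x) -> regular (fwd_la x i).
Proof.
move=> _; exists la_state, la_delta, [set insub (nth ([::],
  [::]) (ch_states x) i)] => t.
by rewrite inE; split=> [[h ->]|[h /eqP]].
Qed.

Lemma fwd_pos_lt x B : B \in ch_links x -> fwd_pos x B < size (links (ch_rule x)).
Proof.
by rewrite mem_filter => /andP[h _];
  rewrite -(size_ch_states x) -(size_map labels) index_mem.
Qed.

Lemma fwd_rhs_ranked x : ranked (fwd_rhs x).
Proof.
rewrite /= size_map links_tag_rule eqxx all_map /=; exact/allP.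
Qed.

Lemma leaves_fwd_rhs x : leaves (fwd_rhs x) = [seq (tt, fwd_pos x B) | B <- ch_links x].
Proof. by rewrite /=; elim: (ch_links x) => //= B Bs ->. Qed.

Lemma fwd_rhs_bound x : all (fun p => p.2 < rk (fwd_sym x)) (leaves (fwd_rhs x)).
Proof. by rewrite leaves_fwd_rhs all_map; apply/allP => B /fwd_pos_lt. Qed.

Lemma ch_links_uniq x : uniq (ch_links x).
Proof. by rewrite filter_uniq // tag_bign_uniq. Qed.

Lemma fwd_rhs_linear x : uniq (map snd (leaves (fwd_rhs x))).
Proof.
rewrite leaves_fwd_rhs -map_comp map_inj_in_uniq ?ch_links_uniq // => B B'.
rewrite !mem_filter => /andP[h _] /andP[h' _] /= e.
by rewrite -(nth_index [::] h) -(nth_index [::] h') -/(fwd_pos x B) e.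
Qed.

(** Two choices with the same rule differ in the skeletons of some link, and the automaton reaches
    only one state on that child. *)
Lemma fwd_deterministic (x x' : fwd_trule) : x != x' -> tt = tt :> unit ->
  fwd_sym x = fwd_sym x' ->
  disjoint_lang (fun t : tree (ruleA G) void => ranked t) (fun t => ranked t) \/
  exists2 i, i < rk (fwd_sym x) & disjoint_lang (fwd_la x i) (fwd_la x' i).
Proof.
move=> ne _ /(congr1 (@ssval _ _)) /= er; right.
have [[_ sz qS] _] := ch_good x; have [[_ sz' qS'] _] := ch_good x'.
have ns : ch_states x != ch_states x'.
  apply: contra ne => /eqP/(congr1 unzip2); rewrite !unzip2_zip ?sz ?sz' // => es.
  apply/eqP/val_inj => /=; rewrite (surjective_pairing (ssval x)) (surjective_pairing
    (ssval x')).
  by move: er es; rewrite /ch_rule /ch_skels => -> ->.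
have szs : size (ch_states x) = size (ch_states x') by rewrite !size_ch_states er.
have: has (fun i => nth (([::], [::]) : skel_state) (ch_states x) i !=
                    nth (([::], [::]) : skel_state) (ch_states x') i) (iota 0 (size
                      (ch_states x))).
  rewrite -[has _ _]negbK -all_predC; apply: contra ns => /allP h.
  apply/eqP; apply: (@eq_from_nth _ ([::], [::])) => // i ilt.
  by apply/eqP; move: (h i); rewrite mem_iota add0n ilt /= negbK; apply.
case/hasP => i; rewrite mem_iota add0n /= => ilt nth_ne.
exists i; first by rewrite /= -size_ch_states.
move=> t [[_ e] [_ e']]; move: nth_ne; rewrite e in e'.
(* [insub] is injective only on states; everything else goes to [None]. *)
have m1 := qS _ (mem_nth ([::], [::]) ilt).
have ilt' : i < size (ch_states x') by rewrite -szs.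
have m2 := qS' _ (mem_nth ([::], [::]) ilt').
by move: e'; rewrite !insubT => -[->]; rewrite eqxx.
Qed.

Definition fwd : ldtr (ruleA G) (ruleA tagG) :=
  @Ldtr (ruleA G) (ruleA tagG) unit tt fwd_trule (fun=> tt) fwd_sym
    (fun _ t => ranked t) fwd_la fwd_rhs (fun _ => ranked_regular (ruleA G))
    fwd_la_regular fwd_rhs_ranked fwd_rhs_bound fwd_rhs_linear fwd_deterministic.

(** By start separation, the initial case of [fwd_trans] arises only at the root of a derivation,
    never at a child. *)
Lemma init_notin_links r B : r \in rules G -> B \in links r -> B != [:: init G].
Proof.
move=> rG Br; apply/eqP => e; have := mc_start_separated rG.
have [_ [_ _ _ <-]] := mc_rules rG; case/negP; apply/flattenP; exists B => //.
by rewrite e mem_head.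
Qed.

Notation gval := (@Defs.tval Sigma tagG).

(** A subderivation whose state has no labels has no counterpart in the new grammar and is deleted;
    the second hypothesis excludes it. *)
Lemma fwd_trans A d : der A d ->
  (A == [:: init G]) || (labels (der_state A d) != [::]) ->
  exists d', [/\ @trans _ _ fwd tt d d',
    der (if A == [:: init G] then [:: None : nt tagG] else labels (der_state A d)) d' &
    gval d' = if A == [:: init G] then dval d else der_pieces d].
Proof.
elim=> r ds sz dd IH kept; have [ok vt fl] := children_ok sz (fun B d h =>
  der_inv (dd B d h)).
have rG : ssval r \in rules G := ssvalP r.
have sz0 : size ds = size (links (ssval r)) := sz.
have gc := children_good sz dd.
have xch : (ssval r, map der_skel ds) \in choices.
  apply/mem_choices; split=> //; case/orP: kept => [h|nl]; first by rewrite /is_init h.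
  by rewrite -size_eq0 -size_pieces size_eq0 /= nl orbT.
pose x : fwd_trule := SeqSub xch.
have szc : size (ch_states x) = size ds by rewrite size_ch_states sz.
have nth_state i : i < size ds -> nth (([::], [::]) : skel_state) (ch_states x) i =
    der_state (nth [::] (links (ssval r)) i) (nth (Node r ds) ds i).
  by move=> ilt; rewrite /ch_states /= nth_zip ?size_map ?sz0 // (nth_map (Node r ds)).
have child i : i < size ds -> (nth [::] (links (ssval r)) i,
  nth (Node r ds) ds i) \in zip (links (ssval r)) ds.
  by move=> ilt; rewrite -nth_zip ?sz0 //; apply: mem_nth;
    rewrite size_zip sz0 minnn -sz0.
pose child_spec (p : unit * nat) (d' : tree (ruleA tagG) void) := p.2 < size ds ->
    labels (nth ([::], [::]) (ch_states x) p.2) != [::] ->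
    [/\ @trans _ _ fwd tt (nth (Node r ds) ds p.2) d',
      @der _ tagG (labels (nth ([::], [::]) (ch_states x) p.2)) d'
    & gval d' = der_pieces (nth (Node r ds) ds p.2)].
have childP p : exists d', child_spec p d'.
  case: p => -[] i; rewrite /child_spec /=.
  case: (boolP ((i < size ds) && (labels (nth ([::],
    [::]) (ch_states x) i) != [::]))) => [/andP[ilt nl]|no]; last first.
    (* A junk tree, for arguments on which [child_spec] demands nothing. *)
    by exists (Node (fwd_rule x) [::]) => ilt nl; rewrite ilt nl in no.
  have ch := child i ilt; rewrite nth_state // in nl *.
  have [|d' [h1 h2 h3]] := IH _ _ ch; first by rewrite nl orbT.
  have Bne := init_notin_links rG (proj1 (in_zip ch)).
  rewrite (negPf Bne) in h2 h3; by exists d'.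
have [g gP] := choice childP.
pose us := [seq gval (g (tt, fwd_pos x B)) | B <- ch_links x].
have pos_lt B : B \in ch_links x -> fwd_pos x B < size ds.
  by move=> /fwd_pos_lt; rewrite sz.
have pos_labels B : B \in ch_links x ->
    labels (nth ([::], [::]) (ch_states x) (fwd_pos x B)) = B.
  move=> Bx; have lt := pos_lt B Bx; move: Bx; rewrite mem_filter => /andP[h _].
  by rewrite -[RHS](nth_index [::] h) (nth_map (([::], [::]) : skel_state)) // szc.
have gB B : B \in ch_links x -> _ := fun h => gP (tt, fwd_pos x B) (pos_lt B h).
have neB B : B \in ch_links x -> B != [::].
  by rewrite mem_filter => /andP[_ /tag_bign_nonempty[]].
have val : gval (lsubst g (fwd_rhs x)) =
    if is_init (ssval r) then dval (Node r ds) else der_pieces (Node r ds).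
  rewrite -(@tag_rule_val r ds us) //; last first.
  - move=> B d1 Bd nl.
    have ilt : index (B, d1) (zip (links (ssval r)) ds) < size ds.
      by move: Bd; rewrite -index_mem size_zip sz0 minnn.
    have := nth_index ([::], Node r ds) Bd; rewrite nth_zip ?sz0 // => -[Bi di].
    have qi := nth_state _ ilt; rewrite Bi di in qi.
    have qx : der_state B d1 \in ch_states x by rewrite -qi mem_nth // szc.
    have Lx : labels (der_state B d1) \in ch_links x.
      by apply/(mem_tag_links gc); exists (der_state B d1).
    have [_ _ qS] := ok.
    have -> : nth [::] us (index (labels (der_state B d1)) (ch_links x)) =
        gval (g (tt, fwd_pos x (labels (der_state B d1)))).
      by rewrite (nth_map [::]) ?index_mem // nth_index.
    have plt := pos_lt _ Lx.
    (* A nonempty sequence of labels determines its state, hence also the position of its link, as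
       the states are distinct. *)
    have nthL : nth (([::], [::]) : skel_state) (ch_states x)
        (fwd_pos x (labels (der_state B d1))) = der_state B d1.
      have := pos_labels _ Lx; case E : (labels (der_state B d1)) nl => [//|C l] _ eqL.
      apply: (@labels_disjoint _ _ C); rewrite ?E ?mem_head //.
      + by apply: qS; apply: mem_nth; rewrite szc -E.
      + exact: qS.
      + by rewrite eqL mem_head.
    have pe : fwd_pos x (labels (der_state B d1)) = index (B,
      d1) (zip (links (ssval r)) ds).
      have us_states : uniq (ch_states x).
        apply: (@map_uniq _ _ fst); have := states_links ok.
        by rewrite /unzip1 /ch_states /= => ->; have [_ []] := mc_rules rG.
      apply/eqP; rewrite -(nth_uniq (([::], [::]) : skel_state) _ _ us_states) ?szc //.
      by rewrite nthL qi.
    have [|_ _ ->] := gB _ Lx; first by rewrite /= nthL.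
    by rewrite /= pe di.
  - by rewrite size_map.
  by rewrite /= links_tag_rule -!map_comp.
exists (lsubst g (fwd_rhs x)); split.
- have rE : fwd_sym x = r by apply: val_inj.
  have := @Trans _ _ fwd x ds g; rewrite /= rE; apply=> //.
  + exact: der_ranked (Der sz dd).
  + move=> i s /(onth_nth (Node r ds))[<- ilt]; split.
      exact: der_ranked (dd _ _ (child i ilt)).
    by rewrite (run_der (dd _ _ (child i ilt))) -nth_state.
  + move=> [] i s; have /= -> := leaves_fwd_rhs x => /mapP[B Bx [->]].
    move=> /(onth_nth (Node r ds))[<- ilt].
    by have [|] := gB B Bx; first by rewrite pos_labels // neB.
- have -> : (if lhs (ssval r) == [:: init G] then [:: None : nt tagG]
    else labels (der_state (lhs (ssval r)) (Node r ds))) = lhs (ssval (fwd_rule x)).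
    by rewrite /= /tag_rule /= /is_init; case: ifP.
  rewrite /=; apply: (@Der _ tagG (fwd_rule x)).
    by rewrite !size_map /= links_tag_rule.
  rewrite /= links_tag_rule -map_comp => B d'.
  have zmap (T X : eqType) (f : T -> X) s y z : (y, z) \in zip s (map f s) ->
    y \in s /\ z = f y.
    by elim: s => //= y' s IHs; rewrite !inE => /predU1P[[-> ->]|/IHs[-> ->]];
      rewrite ?eqxx ?orbT.
  case/zmap => Bx ->; have [|_ h _] := gB B Bx; first by rewrite pos_labels // neB.
  by move: h; rewrite /= pos_labels.
- exact: val.
Qed.

(* The rule r' may come from several choices; one of them is fixed, together with
   derivations that serve as constants for the links that r' has lost. *)
Definition bwd_spec (r' : ruleA tagG) (y : fwd_trule * seq (tree (ruleA G) void)) :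
  Prop :=
  [/\ tag_rule (ssval y.1) = ssval r', map der_skel y.2 = ch_skels y.1,
      size y.2 = size (links (ch_rule y.1))
    & forall B d, (B, d) \in zip (links (ch_rule y.1)) y.2 -> der B d].

Lemma bwd_exists r' : exists y, bwd_spec r' y.
Proof.
have [xs xch e] := mapP (ssvalP r'); pose x : fwd_trule := SeqSub xch.
have [ds [h1 h2 h3]] := choice_derivation (ch_good x).
by exists (x, ds).
Qed.

Definition bwd_choice (r' : ruleA tagG) := projT1 (cid (bwd_exists r')).

Lemma bwd_choiceP r' : bwd_spec r' (bwd_choice r').
Proof. exact: projT2 (cid (bwd_exists r')). Qed.

(** The value of a link without labels is determined by its skeletons alone, so any derivation with
    the same state can stand in for the lost one. *)
Definition bwd_child (x : fwd_trule) (q : skel_state) (d : tree (ruleA G) void) :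
    tree (ruleA G) (unit * nat) :=
  if labels q == [::] then lsubst (@of_void _) d
  else Leaf (tt, index (labels q) (ch_links x)).

Definition bwd_rhs (r' : ruleA tagG) : tree (ruleA G) (unit * nat) :=
  let y := bwd_choice r' in
  Node (fwd_sym y.1) [seq bwd_child y.1 p.1 p.2 | p <- zip (ch_states y.1) y.2].

Lemma leaves_bwd_rhs r' : leaves (bwd_rhs r') =
  [seq (tt, index (labels q) (ch_links (bwd_choice r').1))
  | q <- ch_states (bwd_choice r').1 & labels q != [::]].
Proof.
have [_ _ sz _] := bwd_choiceP r'; rewrite /bwd_rhs /= -map_comp.
move: sz; rewrite -size_ch_states.
elim: (ch_states _) (_.2) => [|q qs IH] [|d ds] //= [/IH ->].
by rewrite /bwd_child; case: eqP => //= _; rewrite leaves_lsubst leaves_void.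
Qed.

Lemma mem_ch_links x q : q \in ch_states x -> labels q != [::] ->
  labels q \in ch_links x.
Proof. by move=> qx nq; apply/(mem_tag_links (ch_good x)); exists q. Qed.

Lemma ch_states_sub x q : q \in ch_states x -> q \in skel_states.
Proof. by have [[_ _ qS] _] := ch_good x; apply: qS. Qed.

Lemma labels_inj q q' : q \in skel_states -> q' \in skel_states -> labels q != [::] ->
  labels q = labels q' -> q = q'.
Proof.
move=> qS qS'; case E : (labels q) => [|C l] // _ e.
by apply: (@labels_disjoint _ _ C) => //; rewrite -?e ?E mem_head.
Qed.

Lemma bwd_rhs_linear r' : uniq (map snd (leaves (bwd_rhs r'))).
Proof.
rewrite leaves_bwd_rhs -map_comp; set x := (bwd_choice r').1.
have [[rG _ _] _] := ch_good x.
rewrite map_inj_in_uniq.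
  apply: filter_uniq; apply: (@map_uniq _ _ fst); have :=
    states_links (proj1 (ch_good x)).
  by rewrite /unzip1 -/(ch_states x) => ->; have [_ []] := mc_rules rG.
move=> q q'; rewrite !mem_filter => /andP[nq qx] /andP[nq' qx'] /= e.
apply: labels_inj; rewrite ?(ch_states_sub qx) ?(ch_states_sub qx') //.
by rewrite -(nth_index [::] (mem_ch_links qx nq)) e nth_index ?mem_ch_links.
Qed.

Lemma bwd_rk r' : @rk (ruleA tagG) r' = size (ch_links (bwd_choice r').1).
Proof. by have [e _ _ _] := bwd_choiceP r'; rewrite /= -e links_tag_rule. Qed.

Lemma bwd_rhs_bound r' : all (fun p => p.2 < @rk (ruleA tagG) r') (leaves (bwd_rhs r')).
Proof.
rewrite leaves_bwd_rhs all_map; apply/allP => q.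
by rewrite mem_filter bwd_rk => /andP[nq qx]; rewrite /= index_mem mem_ch_links.
Qed.

Lemma bwd_rhs_ranked r' : ranked (bwd_rhs r').
Proof.
have [_ _ sz dd] := bwd_choiceP r'.
have sz' : size (ch_states (bwd_choice r').1) = size (bwd_choice r').2
  by rewrite size_ch_states.
rewrite /bwd_rhs /= size_map size_zip sz' minnn sz eqxx /= all_map.
apply/allP => -[[B s] d] qd /=; rewrite /bwd_child; case: ifP => // _.
apply: ranked_lsubst; last by case.
apply: (@der_ranked B); apply: dd.
exact: in_zip_zip qd.
Qed.

Lemma bwd_deterministic (r1 r2 : ruleA tagG) : r1 != r2 -> tt = tt :> unit -> r1 = r2 ->
  disjoint_lang (fun t : tree (ruleA tagG) void => ranked t) (fun t => ranked t) \/
  exists2 i, i < @rk (ruleA tagG) r1 &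
    disjoint_lang (fun t : tree (ruleA tagG) void => ranked t) (fun t => ranked t).
Proof. by move=> /eqP. Qed.

Definition bwd : ldtr (ruleA tagG) (ruleA G) :=
  @Ldtr (ruleA tagG) (ruleA G) unit tt (ruleA tagG) (fun=> tt) id
    (fun _ t => ranked t) (fun _ _ t => ranked t) bwd_rhs
    (fun _ => ranked_regular (ruleA tagG)) (fun _ _ _ => ranked_regular (ruleA tagG))
    bwd_rhs_ranked bwd_rhs_bound bwd_rhs_linear bwd_deterministic.

Lemma tag_der_ranked B d : @der _ tagG B d -> ranked d.
Proof.
elim=> r ds sz _ IH; rewrite /= sz eqxx /=.
move: sz IH => /=; elim: (links (ssval r)) ds => [|B0 Bs IHB] [|d0 ds0] //= [sz] IH.
rewrite (IH B0 d0) ?mem_head // IHB // => B' d' h; apply: (IH B').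
by rewrite inE h orbT.
Qed.

Definition bwd_ok (B : seq tag_nt) (d' : tree (ruleA tagG) void) (d : tree (ruleA G)
  void) : Prop :=
  exists q, [/\ q \in skel_states, labels q = B, der q.1 d, der_skel d = q.2
              & der_pieces d = gval d'].

(** The rebuilt children must have exactly the skeletons of the chosen rule. A child with labels has
    them because its big nonterminal determines its state ([labels_inj]), a constant child by
    [bwd_spec]. Then [tag_rule_val] compares the values. *)
Lemma bwd_trans B d' : @der _ tagG B d' ->
  exists2 d, @trans _ _ bwd tt d' d &
    (B = [:: None] /\ der [:: init G] d /\ dval d = gval d') \/ bwd_ok B d' d.
Proof.
elim=> r' ds' sz' dd' IH.
have [xr cs_skel cs_size cs_der] := bwd_choiceP r'.
move: (erefl (bwd_rhs r')); rewrite {2}/bwd_rhs.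
move: (bwd_choice r') (bwd_rk r') xr cs_skel cs_size cs_der =>
  [x cs] /= szl xr cs_skel cs_size cs_der rhsE.
have szd : size ds' = size (ch_links x) by rewrite sz' -szl.
have lr' : links (ssval r') = ch_links x by rewrite -xr links_tag_rule.
pose d0 := Node r' ds'.
pose spec (p : unit * nat) (d : tree (ruleA G) void) := p.2 < size ds' ->
  @trans _ _ bwd tt (nth d0 ds' p.2) d /\ bwd_ok (nth [::] (ch_links x) p.2) (nth d0
    ds' p.2) d.
have specP p : exists d, spec p d.
  case: p => -[] j; rewrite /spec /=.
  case: (ltnP j (size ds')) => [jlt|_]; last by exists (Node (fwd_sym x) [::]).
  have [|d td hd] := IH (nth [::] (ch_links x) j) (nth d0 ds' j).
    by rewrite lr' -nth_zip ?szd //; apply: mem_nth; rewrite size_zip szd minnn -szd.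
  exists d => _; split=> //; case: hd => // -[e _].
  (* The child is not initial, since [None] is not a label and so no link contains it. *)
  have := mem_nth [::] (n := j) (s := ch_links x); rewrite -szd => /(_ jlt).
  rewrite e => /(mem_tag_links (ch_good x))[q /ch_states_sub qS [eq _]].
  by have := labels_None qS; rewrite -eq mem_head.
have [g gP] := choice specP.
pose us := map gval ds'.
pose child (p : skel_state * tree (ruleA G) void) := lsubst g (bwd_child x p.1 p.2).
pose ds := map child (zip (ch_states x) cs).
have dE : lsubst g (bwd_rhs r') = Node (fwd_sym x) ds by rewrite rhsE /= -map_comp.
have sz_states : size (ch_states x) = size cs by rewrite size_ch_states cs_size.
have csE p : p \in zip (ch_states x) cs -> der p.1.1 p.2 /\ der_skel p.2 = p.1.2.
  have [[_ szs _] _] := ch_good x; move: cs_skel cs_der; rewrite /ch_states.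
  elim: (links _) (ch_skels x) (cs) szs =>
    [|B0 Bs IHB] [|s ss] [|c cs'] //= [szs] [sk sks] dd.
  rewrite inE => /predU1P[->|h] /=; first by split=> //; apply: dd; rewrite mem_head.
  by apply: IHB h => // B1 d1 h; apply: dd; rewrite inE h orbT.
have childP p : p \in zip (ch_states x) cs ->
  [/\ der p.1.1 (child p), der_skel (child p) = p.1.2 &
      labels p.1 != [::] -> der_pieces (child p) = nth [::] us (index (labels p.1)
        (ch_links x))].
  case: p => q c qc; have [dc sc] := csE _ qc; rewrite /child /bwd_child /=.
  case: eqP => [e|/eqP nq].
    by rewrite lsubst_comp (@eq_in_lsubst _ _ _ _ Leaf) ?lsubst_Leaf // => -[].
  have qx := proj1 (in_zip qc); have Lx := mem_ch_links qx nq.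
  have ilt : index (labels q) (ch_links x) < size ds' by rewrite szd index_mem.
  have [_ [q0 [q0S eq0 dq0 sq0 pq0]]] := gP (tt, index (labels q) (ch_links x)) ilt.
  move: eq0; rewrite /= nth_index // => /esym/(labels_inj (ch_states_sub qx) q0S nq) e.
  move: dq0 sq0 pq0; rewrite -e /= => dq0 sq0 pq0; split=> // _.
  by rewrite pq0 (nth_map d0).
have dsk : map der_skel ds = ch_skels x.
  have [[_ szs _] _] := ch_good x.
  have -> : ch_skels x = unzip2 (ch_states x) by rewrite unzip2_zip // szs.
  rewrite -[in RHS](@unzip1_zip _ _ (ch_states x) cs) ?sz_states // /ds /unzip1
    /unzip2 -!map_comp.
  by apply/eq_in_map => p /childP[].
have szds : size ds = @rk (ruleA G) (fwd_sym x).
  by rewrite size_map size_zip sz_states minnn cs_size.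
have zipE B1 d1 : (B1, d1) \in zip (links (ch_rule x)) ds ->
    exists p, [/\ p \in zip (ch_states x) cs, p.1.1 = B1 & child p = d1].
  have -> : links (ch_rule x) = [seq p.1.1 | p <- zip (ch_states x) cs].
    rewrite -(states_links (proj1 (ch_good x))) -/(ch_states x).
    by rewrite -{1}(@unzip1_zip _ _ (ch_states x) cs) ?sz_states // /unzip1 -map_comp.
  by rewrite /ds zip_map => /mapP[p pz [-> ->]]; exists p.
have dds B1 d1 : (B1, d1) \in zip (links (ch_rule x)) ds -> der B1 d1.
  by case/zipE => p [/childP[h _ _] <- <-].
have val : gval (Node r' ds') = if is_init (ch_rule x) then dval (Node (fwd_sym x) ds)
    else der_pieces (Node (fwd_sym x) ds).
  have := @tag_rule_val (fwd_sym x) ds us szds dds; rewrite dsk => <-.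
  - by rewrite /= lr' -xr (surjective_pairing (ssval x)).
  - by rewrite size_map.
  move=> B1 d1 /zipE[p [/childP[_ h1 h2] <- <-]].
  by rewrite /der_state h1 -surjective_pairing => /h2 ->.
have dN : der (lhs (ch_rule x)) (Node (fwd_sym x) ds) by apply: (@Der _ G (fwd_sym x)).
exists (lsubst g (bwd_rhs r')).
  apply: (@Trans _ _ bwd r' ds' g) => //=.
  - have /= -> := tag_der_ranked (@Der _ tagG r' ds' sz' dd').
    by [].
  - move=> i s /(onth_nth d0)[<- ilt].
    apply: (@tag_der_ranked (nth [::] (ch_links x) i)); apply: dd'.
    by rewrite lr' -nth_zip ?szd //; apply: mem_nth; rewrite size_zip szd minnn -szd.
  - move=> [] i s _ /(onth_nth d0)[<- ilt].
    by have [] := gP (tt, i) ilt.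
have lhsE : lhs (ssval r') = if is_init (ch_rule x) then [:: None]
    else labels (lhs (ch_rule x), skel (ch_rule x) (ch_skels x)).
  by rewrite -xr /tag_rule; case: ifP.
rewrite dE lhsE; case: ifP val => ini val.
  by left; split=> //; split; [rewrite -(eqP ini) | exact: esym val].
right; exists (lhs (ch_rule x), skel (ch_rule x) (ch_skels x)); split=> //.
- exact: skel_in_states (proj1 (ch_good x)).
- by rewrite /= dsk.
Qed.

Lemma equivalent_tagG : ldtr_equivalent G tagG.
Proof.
split.
  exists fwd => d dd; have [|d' []] := fwd_trans dd; first by rewrite eqxx.
  by rewrite eqxx => h1 h2 h3; exists d'.
exists bwd => d' dd; have [d td [[_ [h1 h2]]|]] := bwd_trans dd; first by exists d.
by case=> q [qS e]; have := labels_None qS; rewrite e mem_head.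
Qed.


End Construction.

Theorem theorem58 (Sigma : ralphabet) (G : mcftg Sigma)
    (hG : root_consistent (@tree_lang Sigma G)) :
  exists G' : mcftg Sigma,
    [/\ mc_tag G',
        ldtr_equivalent G G',
        multiplicity G' <=
          (if width G == 0 then multiplicity G
           else multiplicity G * #|Sigma| * mr Sigma ^ 2 * (2 * width G - 1))
      & forall Delta : {set Sigma}, lexicalized G Delta -> lexicalized G' Delta].
Proof.
(* [c0] has to be the root symbol of a tree of L(G) whenever there is one. Otherwise any symbol will
   do, and [mc_mr] guarantees that the alphabet is not empty. *)
have [c0 hc0] : exists c0 : Sigma, (exists a, is_root G a) -> is_root G c0.
  have [[a ra]|none] := pselect (exists a, is_root G a); first by exists a.
  case: (pickP (@predT Sigma)) => [a _|no]; first by exists a.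
  by have := mc_mr G; rewrite /mr big1 // => a; have := no a.
exists (tagG G c0); split.
- exact: mc_tag_tagG.
- exact: equivalent_tagG.
- exact: multiplicity_tagG.
- exact: lexicalized_tagG.
Qed.
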